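(* The morphism of symmetric differential graded operads $\mathrm{Lie}\to\Lambda$, where $\mathrm{Lie}$ has zero differential, sending the Lie bracket to $1\curvearrowleft2-2\curvearrowleft1$, is a quasi-isomorphism.
   Context: All operads are symmetric operads in complexes of $\mathbb{Z}$-modules; a morphism is a quasi-isomorphism if it is one in each arity. $\mathrm{Lie}$ is the operad of Lie algebras. Labels in partial compositions are renumbered in the standard way and permutations act by relabelling. $\Lambda$ is the differential graded operad generated by $a=1\curvearrowleft2$ and its transpose $2\curvearrowleft1$, of dimension $0$, and $b=[1,2]=[2,1]$ (symmetric), of dimension $1$, modulo the ideal generated by the relations \begin{align*} a\circ_1a-a\circ_2a&=(2\,3)\cdot(a\circ_1a-a\circ_2a),\\ a\circ_1 b&=(2\,3)\cdot(b\circ_1 a)+b\circ_2a,\\ b\circ_1b+\tau(b\circ_1b)+\tau^2(b\circ_1b)&=0, \end{align*} where $(2\,3)$ is the relabelling exchanging $2$ and $3$ and $\tau$ is the relabelling by the cycle $3\mapsto2\mapsto1\mapsto3$. (The first relation is the pre-Lie relation $(x\curvearrowleft y)\curvearrowleft z-x\curvearrowleft(y\curvearrowleft z)=(x\curvearrowleft z)\curvearrowleft y-x\curvearrowleft(z\curvearrowleft y)$, and the second reads $[1,2]\curvearrowleft 3=[1\curvearrowleft 3,2]+[1,2\curvearrowleft 3]$.) The differential (raising dimension by one) is determined by $d(a)=b$ and $d(b)=0$. *)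

(* Defs.v *)
From HB Require Import structures.
From mathcomp Require Import all_fingroup all_boot all_order all_algebra.
From mathcomp Require Import zify.
From mathcomp Require Import boolp.

Set Implicit Arguments.
Unset Strict Implicit.
Unset Printing Implicit Defensive.

Import GRing.Theory.
Local Open Scope quotient_scope.
Local Open Scope ring_scope.

Record complex := Complex {
  cmod :> int -> zmodType;
  cdiff : forall p, {additive cmod p -> cmod (p + 1)};
  cdiffK : forall p (x : cmod p), cdiff (p + 1) (cdiff p x) = 0
}.
Arguments cdiff {c p}.

Record chainMap (C D : complex) := ChainMap {
  cfun :> forall p, {additive C p -> D p};
  cfun_diff : forall p (x : C p), cfun (p + 1) (cdiff x) = cdiff (cfun p x)
}.
Arguments cfun {C D} _ {p}.

Section Cohomology.
Variable C : complex.

Definition cocycle p : Type := {x : C p | cdiff x == 0}.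
HB.instance Definition _ p := Choice.on (cocycle p).

(* An inductive family rather than an existential statement: the image of
   cdiff in degree p comes from degree q with q + 1 = p, which is not
   definitional for q = p - 1. *)
Inductive coboundary : forall p, C p -> Prop :=
  Coboundary p (y : C p) : coboundary (cdiff y).

Lemma coboundaryP p (x : C (p + 1)) :
  coboundary x <-> exists y : C p, x = cdiff y.
Proof.
split=> [cx|[y ->]]; last exact: Coboundary.
suff gen q (z : C q) : coboundary z ->
    forall e : q = p + 1, exists y : C p, ecast c (C c) e z = cdiff y.
  exact: (gen _ x cx erefl).
case=> {z}r y e; have e' : r = p := addIr _ e.
by subst r; exists y; rewrite eq_axiomK.
Qed.

Lemma coboundary0 p : coboundary (0 : C p).
Proof.
rewrite -[p](subrK 1); apply/coboundaryP; exists 0; by rewrite raddf0.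
Qed.

Lemma coboundaryB p (x y : C p) :
  coboundary x -> coboundary y -> coboundary (x - y).
Proof.
have e := subrK 1 p; move: x y; rewrite -e => x y.
move=> /coboundaryP[u ->] /coboundaryP[v ->].
by apply/coboundaryP; exists (u - v); rewrite raddfB.
Qed.

Definition cohomologous p (x y : cocycle p) : bool :=
  `[< coboundary (val x - val y) >].

Lemma cohomologous_refl p : reflexive (@cohomologous p).
Proof. by move=> x; apply/asboolP; rewrite subrr; exact: coboundary0. Qed.

Lemma cohomologous_sym p : symmetric (@cohomologous p).
Proof.
move=> x y; apply/asboolP/asboolP => h;
  by rewrite -opprB -sub0r; apply: coboundaryB h; exact: coboundary0.
Qed.

Lemma cohomologous_trans p : transitive (@cohomologous p).
Proof.
move=> y x z /asboolP hxy /asboolP hyz; apply/asboolP.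
have hzy : coboundary (val z - val y).
  by rewrite -opprB -sub0r; apply: coboundaryB hyz; exact: coboundary0.
by have := coboundaryB hxy hzy; rewrite opprB addrA subrK.
Qed.

Canonical cohomologous_equiv p := EquivRel (@cohomologous p)
  (@cohomologous_refl p) (@cohomologous_sym p) (@cohomologous_trans p).

Definition cohomology p := {eq_quot (cohomologous_equiv p)}.

End Cohomology.
Arguments coboundary {C p}.

Section CohomologyMap.
Variables (C D : complex) (f : chainMap C D).

Lemma cocycle_map_subproof p (x : cocycle C p) : cdiff (f p (val x)) == 0.
Proof. by rewrite -cfun_diff (eqP (valP x)) raddf0. Qed.

Definition cocycle_map p (x : cocycle C p) : cocycle D p :=
  exist _ (f p (val x)) (cocycle_map_subproof x).

Definition cohomology_map p (h : cohomology C p) : cohomology D p :=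
  \pi_(cohomology D p) (cocycle_map (repr h)).

Lemma cohomology_map_pi p (x : cocycle C p) :
  cohomology_map (\pi_(cohomology C p) x) =
  \pi_(cohomology D p) (cocycle_map x).
Proof.
apply/eqmodP/asboolP.
have /eqmodP/asboolP : repr (\pi_(cohomology C p) x) = x %[mod cohomology C p].
  by rewrite reprK.
rewrite /= -raddfB; move: (_ - _) => z [q y].
by rewrite cfun_diff; exact: Coboundary.
Qed.

End CohomologyMap.

(* The maps induced in cohomology are additive, so that bijective maps are
   isomorphisms of groups. *)
Definition quasi_iso (C D : complex) (f : chainMap C D) : Prop :=
  forall p, bijective (@cohomology_map C D f p).

(* Inputs are numbered from 0: the inputs of an operation of arity n are
   the elements of 'I_n. *)

(* In the partial composition of x with y (of arity n) at the input i of x,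
   the input j != i of x gets number outer n i j, and the input j of y gets
   number i + j. *)
Definition outer (n i j : nat) : nat := if (j < i)%N then j else (j + n).-1.

(* u is the renumbering of the inputs of a composite at i which is induced by
   the renumberings s and t of the inputs of the two factors. *)
Definition block_perm m n k (i : 'I_m) (s : 'S_m) (t : 'S_n) (u : 'S_k) :=
  (forall (j : 'I_m) (l : 'I_k), j != i -> l = outer n i j :> nat ->
     u l = outer n (s i) (s j) :> nat) /\
  (forall (j : 'I_n) (l : 'I_k), l = (i + j)%N :> nat ->
     u l = (s i + t j)%N :> nat).

(* u exists, and it is unique since each input of a composite comes from one
   of the factors. *)
Lemma block_perm_exists m n k (e : (m + n)%N = k.+1) (i : 'I_m)
  (s : 'S_m) (t : 'S_n) : exists u : 'S_k, block_perm i s t u.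
Proof.
have lo (l : 'I_k) : (l < i)%N -> (l < m)%N.
  by move=> h; apply: ltn_trans h (ltn_ord i).
have li (l : 'I_k) : (i <= l < i + n)%N -> (l - i < n)%N by lia.
have lh (l : 'I_k) : (i + n <= l)%N -> (l.+1 - n < m)%N.
  by have := ltn_ord l; lia.
have lto (j : 'I_m) : j != s i -> (outer n (s i) j < k)%N.
  move=> /negP h; have := ltn_ord j; have := ltn_ord (s i).
  have {}h : nat_of_ord j <> s i by move=> h'; apply: h; apply/eqP/val_inj.
  rewrite /outer; case: ifP; lia.
have lti (j : 'I_n) : (s i + j < k)%N.
  have := ltn_ord j; have := ltn_ord (s i); lia.
pose R (l w : 'I_k) :=
  (forall j : 'I_m, j != i -> l = outer n i j :> nat ->
     w = outer n (s i) (s j) :> nat) /\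
  (forall j : 'I_n, l = (i + j)%N :> nat -> w = (s i + t j)%N :> nat).
have nij (j : 'I_m) : j != i -> nat_of_ord j <> i.
  by move=> /negP h h'; apply: h; apply/eqP/val_inj.
pose O l := exists2 j : 'I_m, j != i & l = outer n i j.
pose I l := exists j : 'I_n, l = (i + j)%N.
have cov (l : 'I_k) : O l \/ I l.
  case: (ltnP l i) => h1.
    left; exists (Ordinal (lo l h1)).
      by apply/negP => /eqP/(congr1 val) /=; lia.
    by rewrite /outer /= h1.
  case: (ltnP l (i + n)) => h2.
    by right; exists (Ordinal (li l (introT andP (conj h1 h2)))) => /=; lia.
  left; exists (Ordinal (lh l h2)).
    by apply/negP => /eqP/(congr1 val) /=; have := ltn_ord i; lia.
  by rewrite /outer /=; case: ifP; lia.
have oinj (c : 'I_m) (j j' : 'I_m) : j != c -> j' != c ->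
    outer n c j = outer n c j' -> j = j'.
  move=> /negP h /negP h' E; apply/val_inj.
  have {}h : nat_of_ord j <> c by move=> q; apply: h; apply/eqP/val_inj.
  have {}h' : nat_of_ord j' <> c by move=> q; apply: h'; apply/eqP/val_inj.
  by move: E; rewrite /outer /=; do 2 case: ifP; lia.
have disj (c j : 'I_m) (j' : 'I_n) : j != c -> outer n c j <> (c + j')%N.
  move=> /negP h; have {}h : nat_of_ord j <> c.
    by move=> q; apply: h; apply/eqP/val_inj.
  by rewrite /outer; case: ifP; have := ltn_ord j'; lia.
have snei (j : 'I_m) : j != i -> s j != s i by rewrite (inj_eq perm_inj).
have exR (l : 'I_k) : exists w : 'I_k, R l w.
  case: (cov l) => [[j hj El]|[j El]].
    exists (Ordinal (lto _ (snei j hj))); split=> j' /=.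
      by move=> hj' E; rewrite (oinj i j j') // -El -E.
    by move=> E; case: (disj i j j' hj); rewrite -El.
  exists (Ordinal (lti (t j))); split=> j' /=.
    by move=> hj' E; case: (disj i j' j hj'); rewrite -El.
  move=> E; suff -> : j = j' by [].
  by apply/val_inj; move: El; rewrite E /= => /addnI.
have [w hw] := choice exR.
have winj : injective w.
  move=> l l' E; apply/val_inj => /=.
  have [hO hI] := hw l; have [hO' hI'] := hw l'.
  case: (cov l) => [[j hj El]|[j El]]; case: (cov l') => [[j' hj' El']|[j' El']].
  - have := hO j hj El; rewrite E (hO' j' hj' El') => q.
    have /perm_inj r := oinj (s i) _ _ (snei _ hj) (snei _ hj') (esym q).
    by rewrite El El' r.
  - have := hO j hj El; rewrite E (hI' j' El') => q.
    by case: (disj (s i) (s j) (t j') (snei _ hj)).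
  - have := hI j El; rewrite E (hO' j' hj' El') => q.
    by case: (disj (s i) (s j') (t j) (snei _ hj')).
  - have := hI j El; rewrite E (hI' j' El') => /addnI/val_inj/perm_inj q.
    by rewrite El El' q.
exists (perm winj); split=> j l; rewrite permE; have [hO hI] := hw l.
- exact: hO.
- exact: hI.
Qed.

Definition oddz (p : int) : bool := odd `|p|%N.

Definition signed (U : zmodType) (b : bool) (x : U) : U :=
  if b then - x else x.

(* opact s x is the relabelling of x which replaces each label j by s j; since
   (s * t) j = t (s j) in MathComp, it is a left action of the usual
   symmetric group.  In opcomp, the arity k = m + n - 1 and the degree
   r = p + q of the composite are only required to be propositionally equal
   to these values, so that no transport is needed in the axioms. *)
Record dgOperad := DGOperad {
  opc :> nat -> complex;
  op1 : opc 1 0;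
  opact : forall n p, 'S_n -> {additive opc n p -> opc n p};
  opcomp : forall m n k (e : (m + n)%N = k.+1) (p q r : int) (f : p + q = r)
    (i : 'I_m), opc m p -> opc n q -> opc k r;
  opcompDl : forall m n k (e : (m + n)%N = k.+1) (p q r : int) (f : p + q = r)
    (i : 'I_m) x y (z : opc n q),
    opcomp e f i (x + y) z = opcomp e f i x z + opcomp e f i y z;
  opcompDr : forall m n k (e : (m + n)%N = k.+1) (p q r : int) (f : p + q = r)
    (i : 'I_m) (x : opc m p) y z,
    opcomp e f i x (y + z) = opcomp e f i x y + opcomp e f i x z;
  opact1 : forall n p (x : opc n p), opact p 1%g x = x;
  opactM : forall n p (s t : 'S_n) (x : opc n p),
    opact p (s * t)%g x = opact p t (opact p s x);
  opcomp_act : forall m n k (e : (m + n)%N = k.+1) (p q r : int) (f : p + q = r)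
    (i : 'I_m) (s : 'S_m) (t : 'S_n) (u : 'S_k)
    (x : opc m p) (y : opc n q), block_perm i s t u ->
    opcomp e f (s i) (opact p s x) (opact q t y) =
    opact r u (opcomp e f i x y);
  opcomp1l : forall n (e : (1 + n)%N = n.+1) p (f : 0 + p = p) (i : 'I_1)
    (x : opc n p), opcomp e f i op1 x = x;
  opcomp1r : forall m (e : (m + 1)%N = m.+1) p (f : p + 0 = p) (i : 'I_m)
    (x : opc m p), opcomp e f i x op1 = x;
  opcompA : forall m n l k g h
    (e1 : (m + n)%N = k.+1) (e2 : (k + l)%N = h.+1)
    (e3 : (n + l)%N = g.+1) (e4 : (m + g)%N = h.+1)
    (p q r a b c : int) (f1 : p + q = a) (f2 : a + r = c)
    (f3 : q + r = b) (f4 : p + b = c)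
    (i : 'I_m) (j : 'I_n) (u : 'I_k)
    (x : opc m p) (y : opc n q) (z : opc l r), u = (i + j)%N :> nat ->
    opcomp e2 f2 u (opcomp e1 f1 i x y) z =
    opcomp e4 f4 i x (opcomp e3 f3 j y z);
  (* y and z have degrees q and r: this is the Koszul sign *)
  opcompAC : forall m n l k g h
    (e1 : (m + n)%N = k.+1) (e2 : (k + l)%N = h.+1)
    (e3 : (m + l)%N = g.+1) (e4 : (g + n)%N = h.+1)
    (p q r a b c : int) (f1 : p + q = a) (f2 : a + r = c)
    (f3 : p + r = b) (f4 : b + q = c)
    (i j : 'I_m) (u : 'I_k) (v : 'I_g)
    (x : opc m p) (y : opc n q) (z : opc l r), (i < j)%N ->
    u = outer n i j :> nat -> v = outer l j i :> nat ->
    opcomp e2 f2 u (opcomp e1 f1 i x y) z =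
    signed (oddz q && oddz r) (opcomp e4 f4 v (opcomp e3 f3 j x z) y);
  opdiff1 : cdiff op1 = 0;
  opdiff_act : forall n p (s : 'S_n) (x : opc n p),
    cdiff (opact p s x) = opact (p + 1) s (cdiff x);
  opdiff_comp : forall m n k (e : (m + n)%N = k.+1) (p q r : int) (f : p + q = r)
    (fl : (p + 1) + q = r + 1) (fr : p + (q + 1) = r + 1) (i : 'I_m)
    (x : opc m p) (y : opc n q),
    cdiff (opcomp e f i x y) =
    opcomp e fl i (cdiff x) y + signed (oddz p) (opcomp e fr i x (cdiff y))
}.
Arguments op1 {d}.
Arguments opact {d n p}.
Arguments opcomp {d m n k} e {p q r} f i.

Record dgMorphism (P Q : dgOperad) := DGMorphism {
  opfun :> forall n, chainMap (P n) (Q n);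
  opfun1 : opfun 1%N 0 op1 = op1;
  opfun_act : forall n p (s : 'S_n) (x : P n p),
    opfun n p (opact s x) = opact s (opfun n p x);
  opfun_comp : forall m n k (e : (m + n)%N = k.+1) (p q r : int) (f : p + q = r)
    (i : 'I_m) (x : P m p) (y : P n q),
    opfun k r (opcomp e f i x y) = opcomp e f i (opfun m p x) (opfun n q y)
}.

Definition operad_quasi_iso (P Q : dgOperad) (f : dgMorphism P Q) : Prop :=
  forall n, quasi_iso (f n).

Record signature := Signature {
  gen :> Type;
  gen_arity : gen -> nat;
  gen_degree : gen -> int
}.

Inductive term (G : signature) : nat -> int -> Type :=
| TGen (g : G) : term G (gen_arity g) (gen_degree g)
| TId : term G 1 0
| TAct n p (s : 'S_n) (x : term G n p) : term G n p
| TComp m n k (e : (m + n)%N = k.+1) (p q r : int) (f : p + q = r) (i : 'I_m)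
    (x : term G m p) (y : term G n q) : term G k r
| TZero n p : term G n p
| TOpp n p (x : term G n p) : term G n p
| TAdd n p (x y : term G n p) : term G n p.
Arguments TGen {G}.
Arguments TId {G}.
Arguments TZero {G n p}.
Arguments TComp {G m n k} e {p q r} f i x y.

Definition TSigned G n p (b : bool) (x : term G n p) : term G n p :=
  if b then TOpp x else x.

Lemma degree_Sl (p q r : int) : p + q = r -> (p + 1) + q = r + 1.
Proof. by move=> <-; rewrite addrAC. Qed.

Lemma degree_Sr (p q r : int) : p + q = r -> p + (q + 1) = r + 1.
Proof. by move=> <-; rewrite addrA. Qed.

Section Presentation.
Variables (G : signature) (R : forall n p, term G n p -> term G n p -> Prop).

(* The smallest congruence on terms which contains R and all instances of the
   axioms of graded operads.  The quotient is the free graded operad on G modulo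
   the ideal generated by the differences x - y with R x y. *)
Inductive teq : forall n p, term G n p -> term G n p -> Prop :=
| teq_rel n p (x y : term G n p) : R x y -> teq x y
| teq_refl n p (x : term G n p) : teq x x
| teq_sym n p (x y : term G n p) : teq x y -> teq y x
| teq_trans n p (x y z : term G n p) : teq x y -> teq y z -> teq x z
| teq_act n p s (x x' : term G n p) : teq x x' -> teq (TAct s x) (TAct s x')
| teq_comp m n k (e : (m + n)%N = k.+1) (p q r : int) (f : p + q = r) i
    (x x' : term G m p) (y y' : term G n q) : teq x x' -> teq y y' ->
    teq (TComp e f i x y) (TComp e f i x' y')
| teq_opp n p (x x' : term G n p) : teq x x' -> teq (TOpp x) (TOpp x')
| teq_add n p (x x' y y' : term G n p) :
    teq x x' -> teq y y' -> teq (TAdd x y) (TAdd x' y')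
| teq_addA n p (x y z : term G n p) :
    teq (TAdd x (TAdd y z)) (TAdd (TAdd x y) z)
| teq_addC n p (x y : term G n p) : teq (TAdd x y) (TAdd y x)
| teq_add0 n p (x : term G n p) : teq (TAdd TZero x) x
| teq_addN n p (x : term G n p) : teq (TAdd (TOpp x) x) TZero
| teq_actD n p s (x y : term G n p) :
    teq (TAct s (TAdd x y)) (TAdd (TAct s x) (TAct s y))
| teq_compDl m n k (e : (m + n)%N = k.+1) (p q r : int) (f : p + q = r) i
    (x y : term G m p) (z : term G n q) :
    teq (TComp e f i (TAdd x y) z) (TAdd (TComp e f i x z) (TComp e f i y z))
| teq_compDr m n k (e : (m + n)%N = k.+1) (p q r : int) (f : p + q = r) i
    (x : term G m p) (y z : term G n q) :
    teq (TComp e f i x (TAdd y z)) (TAdd (TComp e f i x y) (TComp e f i x z))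
| teq_act1 n p (x : term G n p) : teq (TAct 1%g x) x
| teq_actM n p s t (x : term G n p) :
    teq (TAct (s * t)%g x) (TAct t (TAct s x))
| teq_comp_act m n k (e : (m + n)%N = k.+1) (p q r : int) (f : p + q = r)
    (i : 'I_m) (s : 'S_m) (t : 'S_n) (u : 'S_k)
    (x : term G m p) (y : term G n q) : block_perm i s t u ->
    teq (TComp e f (s i) (TAct s x) (TAct t y)) (TAct u (TComp e f i x y))
| teq_comp1l n (e : (1 + n)%N = n.+1) p (f : 0 + p = p) i
    (x : term G n p) : teq (TComp e f i TId x) x
| teq_comp1r m (e : (m + 1)%N = m.+1) p (f : p + 0 = p) i
    (x : term G m p) : teq (TComp e f i x TId) x
| teq_compA m n l k g h
    (e1 : (m + n)%N = k.+1) (e2 : (k + l)%N = h.+1)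
    (e3 : (n + l)%N = g.+1) (e4 : (m + g)%N = h.+1)
    (p q r a b c : int) (f1 : p + q = a) (f2 : a + r = c)
    (f3 : q + r = b) (f4 : p + b = c)
    (i : 'I_m) (j : 'I_n) (u : 'I_k)
    (x : term G m p) (y : term G n q) (z : term G l r) :
    u = (i + j)%N :> nat ->
    teq (TComp e2 f2 u (TComp e1 f1 i x y) z)
        (TComp e4 f4 i x (TComp e3 f3 j y z))
| teq_compAC m n l k g h
    (e1 : (m + n)%N = k.+1) (e2 : (k + l)%N = h.+1)
    (e3 : (m + l)%N = g.+1) (e4 : (g + n)%N = h.+1)
    (p q r a b c : int) (f1 : p + q = a) (f2 : a + r = c)
    (f3 : p + r = b) (f4 : b + q = c)
    (i j : 'I_m) (u : 'I_k) (v : 'I_g)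
    (x : term G m p) (y : term G n q) (z : term G l r) : (i < j)%N ->
    u = outer n i j :> nat -> v = outer l j i :> nat ->
    teq (TComp e2 f2 u (TComp e1 f1 i x y) z)
        (TSigned (oddz q && oddz r)
           (TComp e4 f4 v (TComp e3 f3 j x z) y)).

HB.instance Definition _ n p := gen_eqMixin (term G n p).
HB.instance Definition _ n p := gen_choiceMixin (term G n p).

Definition teqb n p (x y : term G n p) : bool := `[< teq x y >].

Lemma teqb_refl n p : reflexive (@teqb n p).
Proof. by move=> x; apply/asboolP; exact: teq_refl. Qed.

Lemma teqb_sym n p : symmetric (@teqb n p).
Proof. by move=> x y; apply/asboolP/asboolP => h; exact: teq_sym. Qed.

Lemma teqb_trans n p : transitive (@teqb n p).
Proof.
by move=> y x z /asboolP xy /asboolP yz; apply/asboolP; exact: teq_trans yz.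
Qed.

Canonical teqb_equiv n p := EquivRel (@teqb n p)
  (@teqb_refl n p) (@teqb_sym n p) (@teqb_trans n p).

Definition presented n p := {eq_quot (teqb_equiv n p)}.
HB.instance Definition _ n p := Choice.on (presented n p).
HB.instance Definition _ n p := EqQuotient.on (presented n p).

Definition cls n p (x : term G n p) : presented n p := \pi x.

Lemma clsP n p (x y : term G n p) : cls x = cls y <-> teq x y.
Proof.
split=> [/eqmodP/asboolP //|h]; exact/eqmodP/asboolP.
Qed.

Lemma cls_surj n p (x : presented n p) : exists t, x = cls t.
Proof. by exists (repr x); rewrite /cls reprK. Qed.

Lemma teq_repr n p (x : term G n p) : teq (repr (cls x)) x.
Proof. by apply/clsP; rewrite /cls reprK. Qed.

Definition pzero n p : presented n p := cls TZero.
Definition popp n p (x : presented n p) : presented n p := cls (TOpp (repr x)).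
Definition padd n p (x y : presented n p) : presented n p :=
  cls (TAdd (repr x) (repr y)).
Definition pact n p (s : 'S_n) (x : presented n p) : presented n p :=
  cls (TAct s (repr x)).
Definition pcomp m n k (e : (m + n)%N = k.+1) (p q r : int) (f : p + q = r) (i : 'I_m)
  (x : presented m p) (y : presented n q) : presented k r :=
  cls (TComp e f i (repr x) (repr y)).

Lemma poppE n p (x : term G n p) : popp (cls x) = cls (TOpp x).
Proof. by apply/clsP/teq_opp/teq_repr. Qed.
Lemma paddE n p (x y : term G n p) : padd (cls x) (cls y) = cls (TAdd x y).
Proof. by apply/clsP/teq_add; exact: teq_repr. Qed.
Lemma pactE n p s (x : term G n p) : pact s (cls x) = cls (TAct s x).
Proof. by apply/clsP/teq_act/teq_repr. Qed.
Lemma pcompE m n k (e : (m + n)%N = k.+1) (p q r : int) (f : p + q = r) (i : 'I_m)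
  (x : term G m p) (y : term G n q) :
  pcomp e f i (cls x) (cls y) = cls (TComp e f i x y).
Proof. by apply/clsP/teq_comp; exact: teq_repr. Qed.

Lemma paddA n p : associative (@padd n p).
Proof.
move=> x y z; have [[[a ->] [b ->]] [c ->]] :=
  (cls_surj x, cls_surj y, cls_surj z).
by rewrite !paddE; apply/clsP/teq_addA.
Qed.
Lemma paddC n p : commutative (@padd n p).
Proof.
move=> x y; have [[a ->] [b ->]] := (cls_surj x, cls_surj y).
by rewrite !paddE; apply/clsP/teq_addC.
Qed.
Lemma padd0 n p : left_id (@pzero n p) (@padd n p).
Proof.
by move=> x; have [a ->] := cls_surj x; rewrite paddE; apply/clsP/teq_add0.
Qed.
Lemma paddN n p : left_inverse (@pzero n p) (@popp n p) (@padd n p).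
Proof.
move=> x; have [a ->] := cls_surj x.
by rewrite poppE paddE; apply/clsP/teq_addN.
Qed.

HB.instance Definition _ n p := GRing.isZmodule.Build (presented n p)
  (@paddA n p) (@paddC n p) (@padd0 n p) (@paddN n p).

Lemma cls0 n p : cls (TZero : term G n p) = 0. Proof. by []. Qed.
Lemma clsN n p (x : term G n p) : cls (TOpp x) = - cls x.
Proof. by rewrite -poppE. Qed.
Lemma clsD n p (x y : term G n p) : cls (TAdd x y) = cls x + cls y.
Proof. by rewrite -paddE. Qed.
Lemma clsS n p b (x : term G n p) : cls (TSigned b x) = signed b (cls x).
Proof. by case: b; rewrite //= clsN. Qed.

Lemma pactD n p s : {morph @pact n p s : x y / x + y}.
Proof.
move=> x y; have [[a ->] [b ->]] := (cls_surj x, cls_surj y).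
by rewrite -clsD !pactE -clsD; apply/clsP/teq_actD.
Qed.

Lemma pact0 n p s : @pact n p s 0 = 0.
Proof. by apply: (addIr (pact s 0)); rewrite -pactD !add0r. Qed.

Lemma pactB n p s : {morph @pact n p s : x y / x - y}.
Proof.
move=> x y; apply: (addIr (pact s y)); by rewrite -pactD !subrK.
Qed.

HB.instance Definition _ n p (s : 'S_n) :=
  GRing.isZmodMorphism.Build (presented n p) (presented n p) (pact s)
    (@pactB n p s).

Definition pact_additive n p (s : 'S_n) :
  {additive presented n p -> presented n p} := @pact n p s.

Lemma pcompDl m n k (e : (m + n)%N = k.+1) (p q r : int) (f : p + q = r) (i : 'I_m)
  x y (z : presented n q) :
  pcomp e f i (x + y) z = pcomp e f i x z + pcomp e f i y z :> presented k r.
Proof.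
have [[[a ->] [b ->]] [c ->]] := (cls_surj x, cls_surj y, cls_surj z).
by rewrite -clsD !pcompE -clsD; apply/clsP/teq_compDl.
Qed.

Lemma pcompDr m n k (e : (m + n)%N = k.+1) (p q r : int) (f : p + q = r) (i : 'I_m)
  (x : presented m p) y z :
  pcomp e f i x (y + z) = pcomp e f i x y + pcomp e f i x z :> presented k r.
Proof.
have [[[a ->] [b ->]] [c ->]] := (cls_surj x, cls_surj y, cls_surj z).
by rewrite -clsD !pcompE -clsD; apply/clsP/teq_compDr.
Qed.

Lemma pact1 n p (x : presented n p) : pact 1%g x = x.
Proof. by have [a ->] := cls_surj x; rewrite pactE; apply/clsP/teq_act1. Qed.

Lemma pactM n p s t (x : presented n p) :
  pact (s * t)%g x = pact t (pact s x).
Proof. by have [a ->] := cls_surj x; rewrite !pactE; apply/clsP/teq_actM. Qed.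

Lemma pcomp_act m n k (e : (m + n)%N = k.+1) (p q r : int) (f : p + q = r)
  (i : 'I_m) (s : 'S_m) (t : 'S_n) (u : 'S_k)
  (x : presented m p) (y : presented n q) : block_perm i s t u ->
  pcomp e f (s i) (pact s x) (pact t y) = pact u (pcomp e f i x y).
Proof.
move=> h; have [[a ->] [b ->]] := (cls_surj x, cls_surj y).
by rewrite !(pactE, pcompE); apply/clsP/teq_comp_act.
Qed.

Definition pid : presented 1 0 := cls TId.

Lemma pcomp1l n (e : (1 + n)%N = n.+1) p (f : 0 + p = p) i
  (x : presented n p) : pcomp e f i pid x = x.
Proof.
by have [a ->] := cls_surj x; rewrite !pcompE; apply/clsP/teq_comp1l.
Qed.

Lemma pcomp1r m (e : (m + 1)%N = m.+1) p (f : p + 0 = p) i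
  (x : presented m p) : pcomp e f i x pid = x.
Proof.
by have [a ->] := cls_surj x; rewrite !pcompE; apply/clsP/teq_comp1r.
Qed.

Lemma pcompA m n l k g h
  (e1 : (m + n)%N = k.+1) (e2 : (k + l)%N = h.+1)
  (e3 : (n + l)%N = g.+1) (e4 : (m + g)%N = h.+1)
  (p q r a b c : int) (f1 : p + q = a) (f2 : a + r = c)
  (f3 : q + r = b) (f4 : p + b = c)
  (i : 'I_m) (j : 'I_n) (u : 'I_k)
  (x : presented m p) (y : presented n q) (z : presented l r) :
  u = (i + j)%N :> nat ->
  pcomp e2 f2 u (pcomp e1 f1 i x y) z =
  pcomp e4 f4 i x (pcomp e3 f3 j y z).
Proof.
move=> hu; have [[[a' ->] [b' ->]] [c' ->]] :=
  (cls_surj x, cls_surj y, cls_surj z).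
by rewrite !pcompE; apply/clsP/teq_compA.
Qed.

Lemma pcompAC m n l k g h
  (e1 : (m + n)%N = k.+1) (e2 : (k + l)%N = h.+1)
  (e3 : (m + l)%N = g.+1) (e4 : (g + n)%N = h.+1)
  (p q r a b c : int) (f1 : p + q = a) (f2 : a + r = c)
  (f3 : p + r = b) (f4 : b + q = c)
  (i j : 'I_m) (u : 'I_k) (v : 'I_g)
  (x : presented m p) (y : presented n q) (z : presented l r) : (i < j)%N ->
  u = outer n i j :> nat -> v = outer l j i :> nat ->
  pcomp e2 f2 u (pcomp e1 f1 i x y) z =
  signed (oddz q && oddz r) (pcomp e4 f4 v (pcomp e3 f3 j x z) y).
Proof.
move=> hij hu hv; have [[[a' ->] [b' ->]] [c' ->]] :=
  (cls_surj x, cls_surj y, cls_surj z).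
by rewrite !pcompE -clsS; apply/clsP/teq_compAC.
Qed.

Lemma pcomp0l m n k (e : (m + n)%N = k.+1) (p q r : int) (f : p + q = r) (i : 'I_m)
  (z : presented n q) : pcomp e f i 0 z = 0 :> presented k r.
Proof. by apply: (addIr (pcomp e f i 0 z)); rewrite -pcompDl !add0r. Qed.
Lemma pcomp0r m n k (e : (m + n)%N = k.+1) (p q r : int) (f : p + q = r) (i : 'I_m)
  (z : presented m p) : pcomp e f i z 0 = 0 :> presented k r.
Proof. by apply: (addIr (pcomp e f i z 0)); rewrite -pcompDr !add0r. Qed.
Lemma pcompNl m n k (e : (m + n)%N = k.+1) (p q r : int) (f : p + q = r) (i : 'I_m)
  x (z : presented n q) : pcomp e f i (- x) z = - pcomp e f i x z.
Proof.
by apply: (addIr (pcomp e f i x z)); rewrite -pcompDl !addNr pcomp0l.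
Qed.
Lemma pcompNr m n k (e : (m + n)%N = k.+1) (p q r : int) (f : p + q = r) (i : 'I_m)
  (x : presented m p) z : pcomp e f i x (- z) = - pcomp e f i x z.
Proof.
by apply: (addIr (pcomp e f i x z)); rewrite -pcompDr !addNr pcomp0r.
Qed.
Lemma pcompSl m n k (e : (m + n)%N = k.+1) (p q r : int) (f : p + q = r) (i : 'I_m)
  b x (z : presented n q) :
  pcomp e f i (signed b x) z = signed b (pcomp e f i x z).
Proof. by case: b; rewrite //= pcompNl. Qed.
Lemma pcompSr m n k (e : (m + n)%N = k.+1) (p q r : int) (f : p + q = r) (i : 'I_m)
  b (x : presented m p) z :
  pcomp e f i x (signed b z) = signed b (pcomp e f i x z).
Proof. by case: b; rewrite //= pcompNr. Qed.

Variable dgen : forall g : G, term G (gen_arity g) (gen_degree g + 1).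

Fixpoint tdiff n p (x : term G n p) : term G n (p + 1) :=
  match x with
  | TGen g => dgen g
  | TId => TZero
  | TAct n p s x => TAct s (tdiff x)
  | TComp m n k e p q r f i x y =>
      TAdd (TComp e (degree_Sl f) i (tdiff x) y)
           (TSigned (oddz p) (TComp e (degree_Sr f) i x (tdiff y)))
  | TZero n p => TZero
  | TOpp n p x => TOpp (tdiff x)
  | TAdd n p x y => TAdd (tdiff x) (tdiff y)
  end.

Hypothesis dgen_rel :
  forall n p (x y : term G n p), R x y -> teq (tdiff x) (tdiff y).
Hypothesis dgen_dgen : forall g, teq (tdiff (dgen g)) TZero.

Lemma oddzD p q : oddz (p + q) = oddz p (+) oddz q.
Proof. rewrite /oddz; lia. Qed.

Lemma oddz1 p : oddz (p + 1) = ~~ oddz p.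
Proof. by rewrite oddzD addbT. Qed.

Lemma signedD (U : zmodType) b (x y : U) :
  signed b (x + y) = signed b x + signed b y.
Proof. by case: b; rewrite //= opprD. Qed.

Lemma signed_signed (U : zmodType) b c (x : U) :
  signed b (signed c x) = signed (b (+) c) x.
Proof. by case: b; case: c; rewrite //= opprK. Qed.

Lemma tdiff_teq n p (x y : term G n p) : teq x y -> teq (tdiff x) (tdiff y).
Proof.
elim=> {n p x y}.
- by move=> n p x y; exact: dgen_rel.
- by move=> n p x; exact: teq_refl.
- by move=> n p x y _; exact: teq_sym.
- by move=> n p x y z _ + _; exact: teq_trans.
- by move=> n p s x x' _; exact: teq_act.
- move=> m n k e p q r f i x x' y y' /clsP hx /clsP dx /clsP hy /clsP dy.
  by apply/clsP; rewrite /= !clsD !clsS -!pcompE hx dx hy dy.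
- by move=> n p x x' _; exact: teq_opp.
- by move=> n p x x' y y' _ + _; exact: teq_add.
- by move=> n p x y z; exact: teq_addA.
- by move=> n p x y; exact: teq_addC.
- by move=> n p x; exact: teq_add0.
- by move=> n p x; exact: teq_addN.
- by move=> n p s x y; exact: teq_actD.
- move=> m n k e p q r f i x y z; apply/clsP.
  rewrite /= !(clsD, clsS) -!pcompE !clsD !pcompDl signedD.
  by rewrite addrACA.
- move=> m n k e p q r f i x y z; apply/clsP.
  rewrite /= !(clsD, clsS) -!pcompE !clsD !pcompDr signedD.
  by rewrite addrACA.
- by move=> n p x; exact: teq_act1.
- by move=> n p s t x; exact: teq_actM.
- move=> m n k e p q r f i s t u x y h; apply/clsP.
  rewrite /= !(clsD, clsS) -!(pcompE, pactE) !(clsD, clsS) -!(pcompE, pactE).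
  rewrite !(pcomp_act _ _ _ _ h) pactD; congr (_ + _).
  by case: (oddz p) => //=; rewrite (raddfN (pact_additive _ _)).
- move=> n e p f i x; apply/clsP.
  by rewrite /= !clsD -!pcompE cls0 pcomp0l add0r pcomp1l.
- move=> n e p f i x; apply/clsP.
  by rewrite /= !(clsD, clsS) -!pcompE cls0 pcomp0r pcomp1r; case: oddz;
     rewrite /= ?oppr0 addr0.
- move=> m n l k g h e1 e2 e3 e4 p q r a b c f1 f2 f3 f4 i j u x y z hu.
  apply/clsP; rewrite /= !(clsD, clsS) -!pcompE !(clsD, clsS) -!pcompE.
  rewrite !(pcompDl, pcompDr, pcompSl, pcompSr) !signedD !signed_signed.
  have oa : oddz a = oddz p (+) oddz q by rewrite -f1 oddzD.
  rewrite oa -addrA; congr (_ + (_ + _)).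
  + exact: pcompA.
  + by congr signed; exact: pcompA.
  + by congr signed; exact: pcompA.
- move=> m n l k g h e1 e2 e3 e4 p q r a b c f1 f2 f3 f4 i j u v x y z hij hu hv.
  apply/clsP; rewrite /= !(clsD, clsS).
  have -> : tdiff (TSigned (oddz q && oddz r)
       (TComp e4 f4 v (TComp e3 f3 j x z) y)) =
     TSigned (oddz q && oddz r) (tdiff (TComp e4 f4 v (TComp e3 f3 j x z) y)).
    by case: andb.
  rewrite clsS /= !(clsD, clsS) -!pcompE !(clsD, clsS) -!pcompE.
  rewrite !(pcompDl, pcompDr, pcompSl, pcompSr) !signedD !signed_signed.
  have oa : oddz a = oddz p (+) oddz q by rewrite -f1 oddzD.
  have ob : oddz b = oddz p (+) oddz r by rewrite -f3 oddzD.
  rewrite oa ob -!addrA; congr (_ + _); first exact: pcompAC.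
  rewrite addrC; congr (_ + _).
  + rewrite (pcompAC e1 e2 e3 e4 f1 (degree_Sr f2)
      (degree_Sr f3) (degree_Sl f4) _ _ _ hij hu hv).
    rewrite signed_signed oddz1; congr signed.
    by case: (oddz p); case: (oddz q); case: (oddz r).
  + rewrite (pcompAC e1 e2 e3 e4 (degree_Sr f1) (degree_Sl f2)
      f3 (degree_Sr f4) _ _ _ hij hu hv).
    rewrite signed_signed oddz1; congr signed.
    by case: (oddz p); case: (oddz q); case: (oddz r).
Qed.

Lemma tdiff_tdiff n p (x : term G n p) : teq (tdiff (tdiff x)) TZero.
Proof.
elim: x => {n p} /=.
- exact: dgen_dgen.
- exact: teq_refl.
- move=> n p s x /clsP IH; apply/clsP.
  by rewrite -pactE IH cls0 pact0.
- move=> m n k e p q r f i x /clsP IHx y /clsP IHy; apply/clsP.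
  rewrite clsD.
  have -> : tdiff (TSigned (oddz p) (TComp e (degree_Sr f) i x (tdiff y))) =
    TSigned (oddz p) (tdiff (TComp e (degree_Sr f) i x (tdiff y))).
    by case: oddz.
  rewrite clsS /= !(clsD, clsS) -!pcompE IHx IHy !cls0 pcomp0l pcomp0r.
  rewrite oddz1 add0r signedD signed_signed addbb /= addr0.
  rewrite (Prop_irrelevance (degree_Sl (degree_Sr f)) (degree_Sr (degree_Sl f))).
  by case: oddz; rewrite /= ?subrr ?addNr.
- by move=> n p; exact: teq_refl.
- move=> n p x /clsP IH; apply/clsP; by rewrite clsN IH cls0 oppr0.
- by move=> n p x /clsP hx y /clsP hy; apply/clsP; rewrite clsD hx hy addr0.
Qed.

Definition pdiff n p (x : presented n p) : presented n (p + 1) :=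
  cls (tdiff (repr x)).

Lemma pdiffE n p (x : term G n p) : pdiff (cls x) = cls (tdiff x).
Proof. by apply/clsP/tdiff_teq/teq_repr. Qed.

Lemma pdiffB n p : {morph @pdiff n p : x y / x - y}.
Proof.
move=> x y; have [[a ->] [b ->]] := (cls_surj x, cls_surj y).
by rewrite -clsN -clsD !pdiffE /= clsD clsN.
Qed.

HB.instance Definition _ n p :=
  GRing.isZmodMorphism.Build (presented n p) (presented n (p + 1))
    (@pdiff n p) (@pdiffB n p).

Lemma pdiffK n p (x : presented n p) : pdiff (pdiff x) = 0.
Proof.
by have [a ->] := cls_surj x; rewrite !pdiffE; apply/clsP/tdiff_tdiff.
Qed.

Definition presented_complex n : complex :=
  @Complex (fun p => presented n p) (fun p => @pdiff n p) (@pdiffK n).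

Lemma pdiff_act n p (s : 'S_n) (x : presented n p) :
  pdiff (pact s x) = pact s (pdiff x).
Proof. by have [a ->] := cls_surj x; rewrite !(pdiffE, pactE). Qed.

Lemma pdiff_comp m n k (e : (m + n)%N = k.+1) (p q r : int) (f : p + q = r)
  (fl : (p + 1) + q = r + 1) (fr : p + (q + 1) = r + 1) (i : 'I_m)
  (x : presented m p) (y : presented n q) :
  pdiff (pcomp e f i x y) =
  pcomp e fl i (pdiff x) y + signed (oddz p) (pcomp e fr i x (pdiff y)).
Proof.
have [[a ->] [b ->]] := (cls_surj x, cls_surj y).
rewrite !(pdiffE, pcompE) /= clsD clsS.
by rewrite (Prop_irrelevance fl (degree_Sl f)) (Prop_irrelevance fr (degree_Sr f)).
Qed.

Lemma pdiff_id : pdiff pid = 0.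
Proof. by rewrite pdiffE. Qed.

Definition presented_operad : dgOperad :=
  @DGOperad presented_complex pid pact_additive pcomp pcompDl pcompDr
    pact1 pactM pcomp_act pcomp1l pcomp1r pcompA pcompAC
    pdiff_id pdiff_act pdiff_comp.

End Presentation.

Definition tcomp2 (G : signature) p q (i : 'I_2)
    (x : term G 2 p) (y : term G 2 q) : term G 3 (p + q) :=
  TComp (erefl : (2 + 2)%N = 4%N) erefl i x y.
Notation "x \o1 y" := (tcomp2 (@Ordinal 2 0 isT) x y)
  (at level 40, left associativity).
Notation "x \o2 y" := (tcomp2 (@Ordinal 2 1 isT) x y)
  (at level 40, left associativity).

(* With inputs numbered from 0: swap12 and swap23 are the transpositions
   (1 2) and (2 3), and cycle3 is the cycle 3 |-> 2 |-> 1 |-> 3. *)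
Definition swap12 : 'S_2 := tperm (@Ordinal 2 0 isT) (@Ordinal 2 1 isT).
Definition swap23 : 'S_3 := tperm (@Ordinal 3 1 isT) (@Ordinal 3 2 isT).
Definition cycle3 : 'S_3 := perm (can_inj (@ord_predK 3)).

Definition TSub G n p (x y : term G n p) : term G n p := TAdd x (TOpp y).

Definition cyclic_sum G p (x : term G 3 p) : term G 3 p :=
  TAdd (TAdd x (TAct cycle3 x)) (TAct cycle3 (TAct cycle3 x)).

Definition lie_sig : signature := @Signature unit (fun _ => 2%N) (fun _ => 0).

Definition lie_gen : term lie_sig 2 0 := @TGen lie_sig tt.

Inductive lie_rel : forall n p, term lie_sig n p -> term lie_sig n p -> Prop :=
| lie_antisym : lie_rel (TAct swap12 lie_gen) (TOpp lie_gen)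
| lie_jacobi : lie_rel (cyclic_sum (lie_gen \o1 lie_gen)) TZero.

Definition lie_diff (g : lie_sig) :
  term lie_sig (gen_arity g) (gen_degree g + 1) := TZero.

Lemma lie_diff_rel n p (x y : term lie_sig n p) :
  lie_rel x y -> teq lie_rel (tdiff lie_diff x) (tdiff lie_diff y).
Proof.
case=> {n p x y}; apply/clsP.
  by rewrite /= clsN -pactE !cls0 pact0 oppr0.
rewrite /= !clsD -!pactE !(clsD, clsS) -!pcompE !cls0.
by rewrite !(pcomp0l, pcomp0r) /= !(addr0, pact0).
Qed.

Lemma lie_diff_diff g : teq lie_rel (tdiff lie_diff (lie_diff g)) TZero.
Proof. exact: teq_refl. Qed.

Definition Lie : dgOperad := presented_operad lie_diff_rel lie_diff_diff.

Definition lie_bracket : Lie 2 0 := cls lie_rel lie_gen.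

(* LambdaA is the operation 1 <- 2, of degree 0; its transpose 2 <- 1 is
   swap12 applied to it, so it needs no generator of its own.  LambdaB is
   [1,2], of degree 1. *)
Inductive lambda_gen := LambdaA | LambdaB.

Definition lambda_sig : signature := @Signature lambda_gen
  (fun _ => 2%N) (fun g => if g is LambdaA then 0 else 1).

Definition lam_a : term lambda_sig 2 0 := @TGen lambda_sig LambdaA.
Definition lam_b : term lambda_sig 2 1 := @TGen lambda_sig LambdaB.

Inductive lambda_rel :
    forall n p, term lambda_sig n p -> term lambda_sig n p -> Prop :=
| lambda_sym : lambda_rel (TAct swap12 lam_b) lam_b
| lambda_prelie : let x := TSub (lam_a \o1 lam_a) (lam_a \o2 lam_a) in
    lambda_rel x (TAct swap23 x)
| lambda_deriv : lambda_rel (lam_a \o1 lam_b)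
    (TAdd (TAct swap23 (lam_b \o1 lam_a)) (lam_b \o2 lam_a))
| lambda_jacobi : lambda_rel (cyclic_sum (lam_b \o1 lam_b)) TZero.

Definition lambda_diff (g : lambda_sig) :
    term lambda_sig (gen_arity g) (gen_degree g + 1) :=
  match g with
  | LambdaA => lam_b
  | LambdaB => TZero
  end.

Section LambdaDiff.

Let P := presented lambda_rel.
Let A : P 2 0 := cls lambda_rel lam_a.
Let B : P 2 1 := cls lambda_rel lam_b.
Let comp2 p q (i : 'I_2) (x : P 2 p) (y : P 2 q) : P 3 (p + q) :=
  pcomp (erefl : (2 + 2)%N = 4%N) erefl i x y.
Let o1 : 'I_2 := @Ordinal 2 0 isT.
Let o2 : 'I_2 := @Ordinal 2 1 isT.

Lemma lambda_symE : pact swap12 B = B.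
Proof. by rewrite pactE; apply/clsP/teq_rel; exact: lambda_sym. Qed.

Lemma lambda_derivE :
  comp2 o1 A B = pact swap23 (comp2 o1 B A) + comp2 o2 B A.
Proof.
by rewrite /comp2 !pcompE pactE -clsD; apply/clsP/teq_rel; exact: lambda_deriv.
Qed.

Lemma lambda_jacobiE : comp2 o1 B B + pact cycle3 (comp2 o1 B B)
  + pact cycle3 (pact cycle3 (comp2 o1 B B)) = 0.
Proof.
rewrite /comp2 !pcompE !pactE -!clsD.
by apply/clsP/teq_rel; exact: lambda_jacobi.
Qed.

Let ord3P (Q : 'I_3 -> Prop) : Q (@Ordinal 3 0 isT) -> Q (@Ordinal 3 1 isT) ->
  Q (@Ordinal 3 2 isT) -> forall l, Q l.
Proof.
move=> h0 h1 h2 [[|[|[|//]]] hl].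
- by move: h0; congr Q; apply: val_inj.
- by move: h1; congr Q; apply: val_inj.
- by move: h2; congr Q; apply: val_inj.
Qed.

Let ord2P (Q : 'I_2 -> Prop) : Q o1 -> Q o2 -> forall l, Q l.
Proof.
move=> h0 h1 [[|[|//]] hl].
- by move: h0; congr Q; apply: val_inj.
- by move: h1; congr Q; apply: val_inj.
Qed.

Let swap12' : 'S_3 := tperm (@Ordinal 3 0 isT) (@Ordinal 3 1 isT).

Let swap12E : (swap12 o1 = o2) * (swap12 o2 = o1).
Proof. by rewrite /swap12 tpermL tpermR. Qed.

Let blk1 : block_perm o1 1%g swap12 swap12'.
Proof.
split; elim/ord2P; elim/ord3P => //=; rewrite ?perm1 ?swap12E //= => _.
- by rewrite /swap12' tpermD.
- by rewrite /swap12' tpermL.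
- by rewrite /swap12' tpermR.
Qed.

Let blk2 : block_perm o2 1%g swap12 swap23.
Proof.
split; elim/ord2P; elim/ord3P => //=; rewrite ?perm1 ?swap12E //= => _.
- by rewrite /swap23 tpermD.
- by rewrite /swap23 tpermL.
- by rewrite /swap23 tpermR.
Qed.

Let cycle3E : ((cycle3 (@Ordinal 3 0 isT) = @Ordinal 3 2 isT) *
  (cycle3 (@Ordinal 3 1 isT) = @Ordinal 3 0 isT) *
  (cycle3 (@Ordinal 3 2 isT) = @Ordinal 3 1 isT))%type.
Proof. by split; [split|]; rewrite permE; apply: val_inj. Qed.

Let blk3 : block_perm o1 swap12 (1%g : 'S_2) (cycle3 * cycle3)%g.
Proof.
split; elim/ord2P; elim/ord3P => //=;
  by rewrite ?permM ?perm1 ?swap12E ?cycle3E ?swap12E.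
Qed.

Let cycle3_swap : cycle3 = (swap12' * swap23)%g.
Proof.
apply/perm.permP; elim/ord3P; rewrite permM cycle3E /swap12' /swap23.
- by rewrite [X in tperm _ _ X]tpermL tpermL.
- by rewrite [X in tperm _ _ X]tpermR tpermD.
- by rewrite [X in tperm _ _ X]tpermD // tpermR.
Qed.

Let BB_swap : pact swap12' (comp2 o1 B B) = comp2 o1 B B.
Proof.
rewrite -(pcomp_act _ _ _ _ blk1) perm1 pact1 lambda_symE //.
Qed.

Let BB_jacobi :
  comp2 o1 B B + pact swap23 (comp2 o1 B B) + comp2 o2 B B = 0.
Proof.
rewrite -[RHS]lambda_jacobiE; congr (_ + _ + _).
  by rewrite cycle3_swap pactM BB_swap.
by rewrite -pactM -(pcomp_act _ _ _ _ blk3) swap12E pact1 lambda_symE.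
Qed.

Let AB_swap : pact swap23 (comp2 o2 A B) = comp2 o2 A B.
Proof.
by rewrite -(pcomp_act _ _ _ _ blk2) perm1 pact1 lambda_symE.
Qed.

Let pcomp_irr m n k (e e' : (m + n)%N = k.+1) (p q r : int)
  (f f' : p + q = r) i (x : P m p) (y : P n q) :
  pcomp e f i x y = pcomp e' f' i x y.
Proof. by rewrite (Prop_irrelevance e e') (Prop_irrelevance f f'). Qed.

Lemma lambda_diff_rel n p (x y : term lambda_sig n p) :
  lambda_rel x y ->
  teq lambda_rel (tdiff lambda_diff x) (tdiff lambda_diff y).
Proof.
case=> {n p x y} => [|w||]; apply/clsP.
- by rewrite /= -pactE cls0 pact0.
- have E : cls lambda_rel (tdiff lambda_diff w) =
      comp2 o1 B A + pact swap23 (comp2 o1 B A) - comp2 o2 A B.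
    rewrite /w /= !(clsD, clsN, clsS) /= -!pcompE.
    have -> : comp2 o1 B A + pact swap23 (comp2 o1 B A) - comp2 o2 A B =
        comp2 o1 B A + comp2 o1 A B - (comp2 o2 B A + comp2 o2 A B).
      by rewrite lambda_derivE opprD !addrA addrK.
    by congr (_ + _ - (_ + _)); apply: pcomp_irr.
  have -> : tdiff lambda_diff (TAct swap23 w) =
      TAct swap23 (tdiff lambda_diff w) by [].
  rewrite -pactE E.
  have inv (u v : P 3 1) : pact swap23 v = v ->
      u + pact swap23 u - v = pact swap23 (u + pact swap23 u - v).
    move=> hv; rewrite pactB pactD hv -pactM tperm2 pact1.
    by rewrite [pact _ _ + _]addrC.
  exact: inv AB_swap.
- rewrite /= !(clsD, clsN) -!pactE !(clsD, clsN) -!pcompE !cls0 /=.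
  rewrite !pcomp0r !pcomp0l.
  have fin (u v w : P 3 2) : u + pact swap23 v + w = 0 ->
      u + 0 = pact swap23 (0 - v) + (0 - w).
    move=> h; rewrite addr0 pactB pact0 !sub0r -opprD.
    by apply/eqP; rewrite -addr_eq0 addrA h.
  apply: fin; rewrite -[RHS]BB_jacobi.
  by congr (_ + pact _ _ + _); apply: pcomp_irr.
- rewrite /= !(clsD, clsN) -!pactE !(clsD, clsN) -!pcompE !cls0 /=.
  by rewrite !(pcomp0l, pcomp0r) !(oppr0, addr0, pact0).
Qed.

Lemma lambda_diff_diff g : teq lambda_rel (tdiff lambda_diff (lambda_diff g)) TZero.
Proof. by case: g; exact: teq_refl. Qed.

End LambdaDiff.

Definition Lambda : dgOperad := presented_operad lambda_diff_rel lambda_diff_diff.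

Definition lambda_a : Lambda 2 0 := cls lambda_rel lam_a.

(* Main.v *)
Require Import Defs.
From mathcomp Require Import all_fingroup all_boot all_order all_algebra.
From HB Require Import structures.
From mathcomp Require Import zify boolp.

Set Implicit Arguments.
Unset Strict Implicit.
Unset Printing Implicit Defensive.

Import GRing.Theory.
Local Open Scope quotient_scope.
Local Open Scope ring_scope.

(**
The proof compares Lambda with Lie through operators defined on all of Lambda,
one pair for each input label l.  Write br for the operation a - a.(1 2), the
image of the Lie bracket.  Read an element of Lambda n as a multilinear
expression in n variables of a free algebra over Lambda.  The operator proj
vanishes on an expression without the variable l, fixes the variable l itself,
and satisfies proj (x <- y) = br (proj x, y) if l occurs in x, proj (x <- y) = 0
if l occurs in y, and proj [x, y] = 0.  In words, it reads x as the variable l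
on which other expressions act on the right, and turns these actions into Lie
brackets.  The operator homot lowers the degree by one, is a derivation of the
product <-, and sends [x, y] to y <- proj x, plus the terms that a derivation
would give, when l occurs in x.  These rules respect the relations of Lambda,
and one finds d homot + homot d = 1 - proj (homotopy).  Where they come from:
the semidirect product of a Lambda-algebra, with its bracket br, by the shifted
Lie algebra of the bracket [ , ], acted upon through <-, is a differential
graded Lie algebra whose underlying complex is the cone of an identity; the
pair (proj, homot) is the graded derivation of it that sends the shifted
variable l to the variable l and every other variable to 0.

On terms these rules are compatible with operadic composition, so that both
operators are given by recursion on terms, with one clause for each operad
operation, and no basis of Lambda is needed.  That they are well defined is the
lemma teq_images; besides the axioms of operads, this uses the consequences in
arity three of the relations of Lambda.

Every proj is homotopic to the identity, hence so is their composite over all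
labels.  After projecting on some labels, the element is an expression in which
these labels are reached from the root through br only; this is the predicate
lieish, and lieish_projc says that one more projection adds one more label.
Once all labels have been treated, the element lies in the image of Lie
(lieish_full).  Hence each cocycle of Lambda is cohomologous to an element in
the image of Lie (lie_onto_cohomology).

For injectivity, a Lie element is a combination of left-normed words
[..[[0, s 1], s 2].., s n] (lie_expansion).  Any ring M gives an evaluation of
Lambda at elements of M, in which a is the product of M and b is zero; it
vanishes on coboundaries (evalc_diff).  Evaluating at elementary matrices that
form a path through the vertices in the order given by a permutation s reads
off the coefficient of the word of s (vertex_lword), so that a Lie element whose
image in Lambda is a coboundary is zero (lie_detect).
*)

(** * Labels of a composite *)

Section Labels.
Variables m n k : nat.
Hypothesis e : (m + n)%N = k.+1.

(** The input l of a composite of x with y at i comes from an input of x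
or from an input of y.  The default value of insubd is never reached for an l
in range. *)
Definition origin (i : 'I_m) (l : nat) : 'I_m + 'I_n :=
  if (l < i)%N then inl (insubd i l)
  else if insub (l - i)%N is Some j then inr j else inl (insubd i (l.+1 - n)%N).

Lemma ord_neq (i j : 'I_m) : j != i -> nat_of_ord j <> i.
Proof. by move=> /negP h h'; apply: h; apply/eqP/val_inj. Qed.

Lemma origin_out (i j : 'I_m) (l : nat) :
  j != i -> l = outer n i j -> origin i l = inl j.
Proof.
move=> /ord_neq h ->; rewrite /origin /outer; have hj := ltn_ord j.
have hi := ltn_ord i.
case: (ltnP j i) => hji; first by rewrite hji; congr inl; apply: val_inj; rewrite val_insubd hj.
have -> : ((j + n).-1 < i)%N = false by lia.
rewrite insubN; last by rewrite -leqNgt; lia.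
congr inl; apply: val_inj; rewrite val_insubd.
have -> : ((j + n).-1.+1 - n)%N = j by lia.
by rewrite hj.
Qed.

Lemma origin_in (i : 'I_m) (j : 'I_n) (l : nat) :
  l = (i + j)%N -> origin i l = inr j.
Proof.
move=> ->; rewrite /origin ltnNge leq_addr /= addKn.
case: insubP => [j' _ E|]; last by rewrite ltn_ord.
by congr inr; apply: val_inj.
Qed.

Variant origin_spec (i : 'I_m) (l : nat) : 'I_m + 'I_n -> Type :=
| OriginOut (j : 'I_m) of j != i & l = outer n i j : origin_spec i l (inl j)
| OriginIn (j : 'I_n) of l = (i + j)%N : origin_spec i l (inr j).

Lemma outer_lt (i j : 'I_m) : j != i -> (outer n i j < k)%N.
Proof.
move=> /ord_neq h; have := ltn_ord j; have := ltn_ord i.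
by rewrite /outer; case: ifP; lia.
Qed.

Lemma inner_lt (i : 'I_m) (j : 'I_n) : (i + j < k)%N.
Proof. have := ltn_ord j; have := ltn_ord i; lia. Qed.

Definition outer_label (i j : 'I_m) (h : j != i) : 'I_k := Ordinal (outer_lt h).
Definition inner_label (i : 'I_m) (j : 'I_n) : 'I_k := Ordinal (inner_lt i j).

Lemma originP (i : 'I_m) (l : 'I_k) : origin_spec i l (origin i l).
Proof.
have hl := ltn_ord l; have hi := ltn_ord i.
case: (ltnP l i) => h1.
  have h : (l < m)%N by lia.
  have hj : Ordinal h != i by apply/negP => /eqP/(congr1 val) /=; lia.
  have E : nat_of_ord l = outer n i (Ordinal h) by rewrite /outer /= h1.
  by rewrite (origin_out hj E); constructor.
case: (ltnP l (i + n)) => h2.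
  have h : (l - i < n)%N by lia.
  have E : nat_of_ord l = (i + Ordinal h)%N by rewrite /=; lia.
  by rewrite (origin_in E); constructor.
have h : (l.+1 - n < m)%N by lia.
have hj : Ordinal h != i by apply/negP => /eqP/(congr1 val) /=; lia.
have E : nat_of_ord l = outer n i (Ordinal h).
  by rewrite /outer /=; case: ifP; lia.
by rewrite (origin_out hj E); constructor.
Qed.
End Labels.
Arguments origin {m} n i l.
Global Opaque origin.

(** * The projection and the homotopy on terms *)

Lemma degree_Pl (p q r : int) : p + q = r -> (p - 1) + q = r - 1.
Proof. by move=> <-; rewrite addrAC. Qed.

Lemma degree_Pr (p q r : int) : p + q = r -> p + (q - 1) = r - 1.
Proof. by move=> <-; rewrite addrA. Qed.

Local Notation pcomp := Defs.pcomp.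
Local Notation PLambda := (presented lambda_rel).
Local Notation lamc := (cls lambda_rel).
Local Notation la := (cls lambda_rel lam_a).
Local Notation lb := (cls lambda_rel lam_b).

(** The image of the Lie bracket, written {x, y} in comments below. *)
Definition lbr : PLambda 2 0 := la - pact swap12 la.

(** The recursion clause for a composite comes from reading x o_i y as the
substitution of y for the variable i of x: if the chosen label l lies in y, then
the occurrence of y in x plays the role of the variable i. *)
Fixpoint proj n p (x : term lambda_sig n p) : 'I_n -> PLambda n p :=
  match x with
  | TGen LambdaA => fun l => if l == 0%N :> nat then lbr else 0
  | TGen LambdaB => fun l => 0
  | TId => fun l => lamc TId
  | TAct n p s x => fun l => pact s (proj x (s^-1%g l))
  | TComp m n k e p q r f i x y => fun l =>
      match origin n i l with
      | inl j => pcomp e f i (proj x j) (lamc y)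
      | inr j => pcomp e f i (proj x i) (proj y j)
      end
  | TZero n p => fun l => 0
  | TOpp n p x => fun l => - proj x l
  | TAdd n p x y => fun l => proj x l + proj y l
  end.

(** Substituting y for the variable i of x, a derivation acts on y in place;
the second summand of the inner clause collects what homot for the variable i
of x adds, where y then occurs through proj y.  The values on b are dictated by
the homotopy formula on a, namely homot b = a - proj a. *)
Fixpoint homot n p (x : term lambda_sig n p) : 'I_n -> PLambda n (p - 1) :=
  match x with
  | TGen LambdaA => fun l => 0
  | TGen LambdaB => fun l => if l == 0%N :> nat then pact swap12 la else la
  | TId => fun l => 0
  | TAct n p s x => fun l => pact s (homot x (s^-1%g l))
  | TComp m n k e p q r f i x y => fun l =>
      match origin n i l with
      | inl j => pcomp e (degree_Pl f) i (homot x j) (lamc y)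
      | inr j => signed (oddz p) (pcomp e (degree_Pr f) i (lamc x) (homot y j))
                 + pcomp e (degree_Pl f) i (homot x i) (proj y j)
      end
  | TZero n p => fun l => 0
  | TOpp n p x => fun l => - homot x l
  | TAdd n p x y => fun l => homot x l + homot y l
  end.

(** * Relations in arity three *)

Local Notation o1 := (@Ordinal 2 0 isT).
Local Notation o2 := (@Ordinal 2 1 isT).
Local Notation tau := (pact swap12).

Definition cmp (G : signature) (R : forall n p, term G n p -> term G n p -> Prop)
    p q (i : 'I_2) (x : presented R 2 p) (y : presented R 2 q) : presented R 3 (p + q) :=
  pcomp (erefl : (2 + 2)%N = 4%N) erefl i x y.

Definition swap_first : 'S_3 := tperm (@Ordinal 3 0 isT) (@Ordinal 3 1 isT).

Lemma ord3P (Q : 'I_3 -> Prop) : Q (@Ordinal 3 0 isT) -> Q (@Ordinal 3 1 isT) ->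
  Q (@Ordinal 3 2 isT) -> forall l, Q l.
Proof.
move=> h0 h1 h2 [[|[|[|//]]] hl].
- by move: h0; congr Q; apply: val_inj.
- by move: h1; congr Q; apply: val_inj.
- by move: h2; congr Q; apply: val_inj.
Qed.

Lemma ord2P (Q : 'I_2 -> Prop) : Q o1 -> Q o2 -> forall l, Q l.
Proof.
move=> h0 h1 [[|[|//]] hl].
- by move: h0; congr Q; apply: val_inj.
- by move: h1; congr Q; apply: val_inj.
Qed.

Local Ltac perm3 :=
  apply/perm.permP; elim/ord3P; apply: val_inj; rewrite ?permM ?permE /= ?permE //.

Lemma block_swap1 : block_perm o1 1%g swap12 swap_first.
Proof. by split; elim/ord2P; elim/ord3P => //=; rewrite ?perm1 ?permE. Qed.
Lemma block_swap2 : block_perm o2 1%g swap12 swap23.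
Proof. by split; elim/ord2P; elim/ord3P => //=; rewrite ?perm1 ?permE. Qed.
Lemma block_swap3 : block_perm o1 swap12 (1%g : 'S_2) (cycle3 * cycle3)%g.
Proof. by split; elim/ord2P; elim/ord3P => //=; rewrite ?permM ?perm1 ?permE /= ?permE. Qed.
Lemma block_swap4 : block_perm o2 swap12 (1%g : 'S_2) cycle3.
Proof. by split; elim/ord2P; elim/ord3P => //=; rewrite ?permM ?perm1 ?permE /= ?permE. Qed.
Lemma cycle3M : (cycle3 * cycle3 * cycle3)%g = 1%g.
Proof. by perm3. Qed.
Lemma cycle3_swap : cycle3 = (swap_first * swap23)%g.
Proof. by perm3. Qed.
Lemma swap23_cycle3 : swap23 = (swap_first * cycle3)%g.
Proof. by perm3. Qed.

Section Arity3.
Variables (G : signature) (R : forall n p, term G n p -> term G n p -> Prop).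
Local Notation P := (presented R).

Lemma cmpBl p q i (x y : P 2 p) (z : P 2 q) :
  cmp i (x - y) z = cmp i x z - cmp i y z.
Proof. by rewrite /cmp pcompDl pcompNl. Qed.
Lemma cmpBr p q i (x : P 2 p) (y z : P 2 q) :
  cmp i x (y - z) = cmp i x y - cmp i x z.
Proof. by rewrite /cmp pcompDr pcompNr. Qed.
Lemma cmpNl p q i (x : P 2 p) (z : P 2 q) : cmp i (- x) z = - cmp i x z.
Proof. exact: pcompNl. Qed.
Lemma cmpNr p q i (x : P 2 p) (z : P 2 q) : cmp i x (- z) = - cmp i x z.
Proof. exact: pcompNr. Qed.

Lemma cmp_swapr1 p q (x : P 2 p) (y : P 2 q) :
  cmp o1 x (tau y) = pact swap_first (cmp o1 x y).
Proof. by rewrite /cmp -(pcomp_act _ _ _ _ block_swap1) perm1 pact1. Qed.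
Lemma cmp_swapr2 p q (x : P 2 p) (y : P 2 q) :
  cmp o2 x (tau y) = pact swap23 (cmp o2 x y).
Proof. by rewrite /cmp -(pcomp_act _ _ _ _ block_swap2) perm1 pact1. Qed.
Lemma cmp_swapl2 p q (x : P 2 p) (y : P 2 q) :
  cmp o2 (tau x) y = pact (cycle3 * cycle3)%g (cmp o1 x y).
Proof. by rewrite /cmp -(pcomp_act _ _ _ _ block_swap3) pact1 permE. Qed.
Lemma cmp_swapl1 p q (x : P 2 p) (y : P 2 q) :
  cmp o1 (tau x) y = pact cycle3 (cmp o2 x y).
Proof. by rewrite /cmp -(pcomp_act _ _ _ _ block_swap4) pact1 permE. Qed.

Lemma pactN n p (s : 'S_n) (x : P n p) : pact s (- x) = - pact s x.
Proof. exact: (raddfN (@pact_additive _ R n p s)). Qed.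

(** The sum over the cyclic group of order three; it does not distinguish
the transpositions, which makes the Jacobi identity of a commutator a formal
consequence of the pre-Lie relation. *)
Definition cyc p (x : P 3 p) : P 3 p :=
  x + pact cycle3 x + pact (cycle3 * cycle3)%g x.

Lemma cycE p (x : P 3 p) : cyc (pact cycle3 x) = cyc x.
Proof. by rewrite /cyc -!pactM mulgA cycle3M pact1 addrC addrA. Qed.
Lemma cycB p (x y : P 3 p) : cyc (x - y) = cyc x - cyc y.
Proof. by rewrite /cyc !pactB (addrACA x) -opprD addrACA -opprD. Qed.
Lemma cyc_swap p (x : P 3 p) : cyc (pact swap_first x) = cyc (pact swap23 x).
Proof. by rewrite swap23_cycle3 pactM cycE. Qed.

(** The Jacobi identity for an antisymmetric bracket, in the form
[[x,y],z] = [[x,z],y] + [x,[y,z]]. *)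
Lemma jacobi_cmp2 p (c : P 2 p) : tau c = - c -> cyc (cmp o1 c c) = 0 ->
  cmp o1 c c = pact swap23 (cmp o1 c c) + cmp o2 c c.
Proof.
move=> antisym; rewrite /cyc -cmp_swapl2 antisym cmpNl cycle3_swap pactM.
rewrite -cmp_swapr1 antisym cmpNr pactN => /eqP.
by rewrite -addrA -opprD subr_eq0 => /eqP.
Qed.

Lemma cyc_rotate p (u v w : P 3 p) :
  u + pact cycle3 v + pact (cycle3 * cycle3)%g w = 0 ->
  [/\ w + pact cycle3 u + pact cycle3 (pact cycle3 v) = 0,
      v + pact cycle3 w + pact cycle3 (pact cycle3 u) = 0
    & u + pact cycle3 v + pact cycle3 (pact cycle3 w) = 0].
Proof.
have c3 (x : P 3 p) : pact cycle3 (pact cycle3 (pact cycle3 x)) = x.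
  by rewrite -!pactM mulgA cycle3M pact1.
rewrite pactM => H; split=> //.
  by rewrite -[RHS](pact0 _ _ cycle3) -H !pactD c3 [RHS]addrC addrA.
rewrite -[RHS](pact0 _ _ (cycle3 * cycle3)%g) -H pactM !pactD !c3.
by rewrite -[RHS]addrA [RHS]addrC.
Qed.
End Arity3.

Lemma prelieE : cmp o1 la la - cmp o2 la la =
  pact swap23 (cmp o1 la la) - pact swap23 (cmp o2 la la).
Proof.
rewrite -pactB /cmp !pcompE -clsN -clsD pactE.
by apply/clsP/teq_rel/lambda_prelie.
Qed.

Lemma prelie_commutator : cmp o1 la la =
  pact swap23 (cmp o1 la la) + cmp o2 la lbr.
Proof.
rewrite /lbr cmpBr cmp_swapr2 addrCA -prelieE.
by rewrite [RHS]addrC subrK.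
Qed.

Lemma lbr_antisym : tau lbr = - lbr.
Proof. by rewrite /lbr pactB -pactM tperm2 pact1 opprB. Qed.

(** Expanding both brackets, the cyclic sum consists of the cyclic sums of the
two sides of the pre-Lie relation. *)
Lemma lbr_jacobi : cyc (cmp o1 lbr lbr) = 0.
Proof.
rewrite {1}/lbr !cmpBl cmp_swapl1 cycB cycE -cycB.
rewrite /lbr !cmpBr cmp_swapr1 cmp_swapr2 cycB (cycB _ (pact swap_first _)) cyc_swap.
rewrite -(cycB _ (pact swap23 (cmp o1 _ _))).
have -> : cmp o1 la la - pact swap23 (cmp o1 la la) =
    cmp o2 la la - pact swap23 (cmp o2 la la).
  by rewrite -cmp_swapr2 -cmpBr {1}prelie_commutator [_ + cmp _ _ _]addrC addrK.
by rewrite !cycB [LHS]subrr.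
Qed.

(** What proj_rel needs for the pre-Lie relation and the first label:
{{x,y},z} - {x, y <- z} is symmetric in y and z. *)
Lemma proj_prelie : cmp o1 lbr lbr - cmp o2 lbr la =
  pact swap23 (cmp o1 lbr lbr - cmp o2 lbr la).
Proof.
rewrite pactB -cmp_swapr2 {1}(jacobi_cmp2 lbr_antisym lbr_jacobi) -addrA; congr (_ + _).
by rewrite /lbr cmpBr [LHS]addrC addKr.
Qed.

(** What homot_rel needs for the derivation relation and the first label:
the pre-Lie relation (y <- x) <- z = y <- {x,z} + (y <- z) <- x. *)
Lemma deriv_a1 : cmp o1 la (tau la) = pact swap23 (cmp o1 (tau la) lbr) + cmp o2 (tau la) la.
Proof.
rewrite cmp_swapr1 prelie_commutator pactD [LHS]addrC cmp_swapl1 cmp_swapl2 -!pactM.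
congr (_ + _); last by congr pact; perm3.
rewrite -[LHS](pact1) -[in LHS]pactM; congr pact; perm3.
Qed.

Lemma cmp_b2 p (y : PLambda 2 p) : cmp o2 lb y = pact (cycle3 * cycle3)%g (cmp o1 lb y).
Proof. by rewrite -{1}lambda_symE cmp_swapl2. Qed.

(** What homot_rel needs for the Jacobi relation of b: the derivation relation
expressed through b o_1 a only. *)
Lemma deriv_cyc :
 cmp o1 la lb + pact cycle3 (- cmp o1 lb (tau la)) + pact (cycle3 * cycle3)%g (- cmp o1 lb la) = 0.
Proof.
have E : cmp o1 la lb = pact swap23 (cmp o1 lb la) + cmp o2 lb la
  := lambda_derivE.
rewrite E cmp_b2 cmp_swapr1 !pactN /= -pactM -swap23_cycle3.
by rewrite [X in X - _]addrAC [X in X + _ - _]subrr [X in X - _]add0r [LHS]subrr.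
Qed.

(** * Invariance under the congruence *)

Lemma signed0 (U : zmodType) b : signed b (0 : U) = 0.
Proof. by case: b; rewrite //= oppr0. Qed.

(** Degrees such as 1 - 1 and 0 are convertible, so that this also relates
composites whose degree equations look different. *)
Lemma pcomp_irr (G : signature) (R : forall n p, term G n p -> term G n p -> Prop)
  m n k (e e' : (m + n)%N = k.+1) (p q r : int)
  (f f' : p + q = r) i (x : presented R m p) (y : presented R n q) :
  pcomp e f i x y = pcomp e' f' i x y.
Proof. by rewrite (Prop_irrelevance e e') (Prop_irrelevance f f'). Qed.

(** The general rule addr0 also matches inside the degree that indexes the
type; this form and the next two match elements only. *)
Lemma paddr0 n p (x : PLambda n p) : x + 0 = x. Proof. exact: addr0. Qed.
Lemma padd0r n p (x : PLambda n p) : 0 + x = x. Proof. exact: add0r. Qed.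
Lemma popp0 n p : - 0 = 0 :> PLambda n p. Proof. exact: oppr0. Qed.

Local Notation ord30 := (@Ordinal 3 0 isT).
Local Notation ord31 := (@Ordinal 3 1 isT).
Local Notation ord32 := (@Ordinal 3 2 isT).

Lemma origin2 : ((origin 2 o1 0 = inr o1) * (origin 2 o1 1 = inr o2) *
 (origin 2 o1 2 = inl o2) * (origin 2 o2 0 = inl o1) * (origin 2 o2 1 = inr o1)
 * (origin 2 o2 2 = inr o2))%type.
Proof.
do !split; first [exact: origin_in | exact: origin_out].
Qed.

Lemma swap12V : ((swap12^-1%g o1 = o2) * (swap12^-1%g o2 = o1))%type.
Proof. by rewrite /swap12 tpermV tpermL tpermR. Qed.
Lemma swap23V : ((swap23^-1%g ord30 = ord30) * (swap23^-1%g ord31 = ord32) * (swap23^-1%g ord32 = ord31))%type.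
Proof. by rewrite /swap23 tpermV tpermL tpermR tpermD. Qed.
Lemma cycle3V : ((cycle3^-1%g ord30 = ord31) * (cycle3^-1%g ord31 = ord32) * (cycle3^-1%g ord32 = ord30))%type.
Proof.
have <- : (cycle3 * cycle3)%g = cycle3^-1%g.
  by apply/eqP; rewrite eq_sym eq_invg_mul mulgA cycle3M.
by do !split; apply: val_inj; rewrite permM !permE /= ?permE.
Qed.

Lemma proj_rel n p (x y : term lambda_sig n p) : lambda_rel x y ->
  forall l, proj x l = proj y l.
Proof.
case=> {n p x y} => [|x||].
- by elim/ord2P; rewrite /= pact0.
- elim/ord3P; rewrite /x /= ?swap23V /= ?origin2 /= ?pcomp0l ?pcomp0r ?oppr0 ?addr0 ?pact0 //.
  exact: proj_prelie.
- by elim/ord3P; rewrite /= ?swap23V /= ?origin2 /= ?pcomp0l ?pcomp0r ?oppr0 ?addr0 ?pact0.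
- by elim/ord3P; rewrite /= ?cycle3V /= ?origin2 /= ?pcomp0l ?pcomp0r ?addr0 ?pact0 ?addr0.
Qed.

Lemma homot_rel n p (x y : term lambda_sig n p) : lambda_rel x y ->
  forall l, homot x l = homot y l.
Proof.
case=> {n p x y} => [|x||].
- by elim/ord2P; rewrite /= swap12V //= -pactM tperm2 pact1.
- by elim/ord3P; rewrite /x /= ?swap23V /= ?origin2 /= ?(pcomp0l, pcomp0r, addr0, pact0, oppr0).
- elim/ord3P; rewrite /= ?swap23V /= ?origin2 /=;
    rewrite ?(popp0, pcomp0l, pcomp0r, paddr0, pact0, padd0r) ?paddr0 ?padd0r //.
  + apply: etrans (etrans _ deriv_a1) _; first exact: pcomp_irr.
    by congr (pact _ _ + _); exact: pcomp_irr.
  + apply: etrans (etrans _ prelie_commutator) _; first exact: pcomp_irr.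
    by congr (pact _ _ + _); exact: pcomp_irr.
- have [E0 E1 E2] := cyc_rotate deriv_cyc.
  elim/ord3P; rewrite /= ?cycle3V /= ?origin2 /=;
    rewrite ?(popp0, pcomp0l, pcomp0r, paddr0, pact0, padd0r) ?paddr0 ?padd0r //.
  + apply: etrans E1.
    by congr (- _ + pact _ (- _) + pact _ (pact _ _)); exact: pcomp_irr.
  + apply: etrans E0.
    by congr (- _ + pact _ _ + pact _ (pact _ (- _))); exact: pcomp_irr.
  + apply: etrans E2.
    by congr (_ + pact _ (- _) + pact _ (pact _ (- _))); exact: pcomp_irr.
Qed.

Section CompLabels.
Variables (m n k : nat) (e : (m + n)%N = k.+1) (p q r : int) (f : p + q = r).
Variables (i : 'I_m) (x : term lambda_sig m p) (y : term lambda_sig n q).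

Lemma proj_out (j : 'I_m) (l : 'I_k) : j != i -> l = outer n i j :> nat ->
  proj (TComp e f i x y) l = pcomp e f i (proj x j) (lamc y).
Proof. by move=> h E; rewrite /= (origin_out e h E). Qed.
Lemma proj_in (j : 'I_n) (l : 'I_k) : l = (i + j)%N :> nat ->
  proj (TComp e f i x y) l = pcomp e f i (proj x i) (proj y j).
Proof. by move=> E; rewrite /= (origin_in E). Qed.
Lemma homot_out (j : 'I_m) (l : 'I_k) : j != i -> l = outer n i j :> nat ->
  homot (TComp e f i x y) l = pcomp e (degree_Pl f) i (homot x j) (lamc y).
Proof. by move=> h E; rewrite /= (origin_out e h E). Qed.
Lemma homot_in (j : 'I_n) (l : 'I_k) : l = (i + j)%N :> nat ->
  homot (TComp e f i x y) l =
    signed (oddz p) (pcomp e (degree_Pr f) i (lamc x) (homot y j))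
    + pcomp e (degree_Pl f) i (homot x i) (proj y j).
Proof. by move=> E; rewrite /= (origin_in E). Qed.
End CompLabels.

Lemma pact_signed n p b (s : 'S_n) (x : PLambda n p) :
  pact s (signed b x) = signed b (pact s x).
Proof. by case: b; rewrite //= pactN. Qed.

Lemma proj_TSigned n p b (x : term lambda_sig n p) l : proj (TSigned b x) l = signed b (proj x l).
Proof. by case: b. Qed.
Lemma homot_TSigned n p b (x : term lambda_sig n p) l : homot (TSigned b x) l = signed b (homot x l).
Proof. by case: b. Qed.
Lemma oddzB1 p : oddz (p - 1) = ~~ oddz p.
Proof. by rewrite -{2}(subrK 1 p) oddz1 negbK. Qed.

Lemma proj_act n p (s : 'S_n) (x : term lambda_sig n p) l :
  proj (TAct s x) (s l) = pact s (proj x l).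
Proof. by rewrite /= permK. Qed.
Lemma homot_act n p (s : 'S_n) (x : term lambda_sig n p) l :
  homot (TAct s x) (s l) = pact s (homot x l).
Proof. by rewrite /= permK. Qed.

Definition same_images n p (x y : term lambda_sig n p) :=
  [/\ lamc x = lamc y, forall l, proj x l = proj y l &
    forall l, homot x l = homot y l].

Lemma same_images_act m n k (e : (m + n)%N = k.+1) (p q r : int) (f : p + q = r)
    (i : 'I_m) (s : 'S_m) (t : 'S_n) (u : 'S_k)
    (x : term lambda_sig m p) (y : term lambda_sig n q) : block_perm i s t u ->
    same_images (TComp e f (s i) (TAct s x) (TAct t y)) (TAct u (TComp e f i x y)).
Proof.
move=> h; split; first by apply/clsP; exact: teq_comp_act.
- move=> l; rewrite -(permKV u l); move: (_ l) => {}l; rewrite proj_act.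
  case: (originP e i l) => [j hj E|j E].
  + have E' := h.1 j l hj E; have hj' : s j != s i by rewrite (inj_eq perm_inj).
    rewrite (proj_out _ _ _ _ hj' E') (proj_out _ _ _ _ hj E) ?(proj_act, homot_act) -pactE.
    exact: pcomp_act.
  + have E' := h.2 j l E.
    rewrite (proj_in _ _ _ _ E') (proj_in _ _ _ _ E) !proj_act.
    exact: pcomp_act.
- move=> l; rewrite -(permKV u l); move: (_ l) => {}l; rewrite homot_act.
  case: (originP e i l) => [j hj E|j E].
  + have E' := h.1 j l hj E; have hj' : s j != s i by rewrite (inj_eq perm_inj).
    rewrite (homot_out _ _ _ _ hj' E') (homot_out _ _ _ _ hj E) ?(proj_act, homot_act) -pactE.
    exact: pcomp_act.
  + have E' := h.2 j l E.
    rewrite (homot_in _ _ _ _ E') (homot_in _ _ _ _ E) !(proj_act, homot_act) -pactE.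
    by rewrite pactD pact_signed !(pcomp_act _ _ _ _ h).
Qed.

Section AssocLabels.
Variables (m n l k g h : nat).
Variables (e1 : (m + n)%N = k.+1) (e2 : (k + l)%N = h.+1).
Variables (e3 : (n + l)%N = g.+1) (e4 : (m + g)%N = h.+1).
Variables (i : 'I_m) (j : 'I_n) (u : 'I_k).
Hypothesis hu : u = (i + j)%N :> nat.

(** In a composite x o_i (y o_j z), a label belongs to x, y or z; each case
gives its positions in all the intermediate composites. *)
Variant assoc_label_spec (w : 'I_h) : Prop :=
| LabelA1 (v : 'I_m) (v1 : 'I_k) of v != i & w = outer g i v :> nat &
    v1 != u & v1 = outer n i v :> nat & w = outer l u v1 :> nat
| LabelA2 (v : 'I_n) (v1 : 'I_k) (v2 : 'I_g) of w = (i + v2)%N :> nat &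
    v != j & v2 = outer l j v :> nat & v1 != u & v1 = (i + v)%N :> nat &
    w = outer l u v1 :> nat
| LabelA3 (v : 'I_l) (v2 : 'I_g) of w = (i + v2)%N :> nat &
    v2 = (j + v)%N :> nat & w = (u + v)%N :> nat.

Lemma assoc_labelP w : assoc_label_spec w.
Proof.
case: (originP e4 i w) => [v hv Ev|v2 Ew].
- apply: (@LabelA1 w v (outer_label e1 hv)) => //=.
    apply/negP => /eqP/(congr1 val) /=; move: (ord_neq hv).
    by rewrite hu /outer; case: ifP; have := ltn_ord j; lia.
  move: (ord_neq hv); rewrite Ev hu /= /outer.
  by have := ltn_ord j; do ![case: ifP]; lia.
- case: (originP e3 j v2) => [v hv Ev|v Ev].
  + apply: (@LabelA2 w v (inner_label e1 i v) v2) => //=.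
      by apply/negP => /eqP/(congr1 val) /=; move: (ord_neq hv); rewrite hu; lia.
    move: (ord_neq hv); rewrite Ew Ev hu /= /outer.
    by do ![case: ifP]; lia.
  + by apply: (@LabelA3 w v v2) => //; rewrite Ew Ev hu addnA.
Qed.
End AssocLabels.

Section ParallelLabels.
Variables (m n l k g h : nat).
Variables (e1 : (m + n)%N = k.+1) (e2 : (k + l)%N = h.+1).
Variables (e3 : (m + l)%N = g.+1) (e4 : (g + n)%N = h.+1).
Variables (i j : 'I_m) (u : 'I_k) (v : 'I_g).
Hypothesis hij : (i < j)%N.
Hypothesis hu : u = outer n i j :> nat.
Hypothesis hv : v = outer l j i :> nat.

(** In a composite of x with y at i and with z at j, for i < j, a label
belongs to x, y or z; each case gives its positions in both iterated composites. *)
Variant parallel_label_spec (w : 'I_h) : Prop :=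
| LabelAC1 (t : 'I_m) (t1 : 'I_k) (t2 : 'I_g) of t != i & t != j &
    t1 != u & t1 = outer n i t :> nat & w = outer l u t1 :> nat &
    t2 != v & t2 = outer l j t :> nat & w = outer n v t2 :> nat
| LabelAC2 (t : 'I_n) (t1 : 'I_k) of t1 != u & t1 = (i + t)%N :> nat &
    w = outer l u t1 :> nat & w = (v + t)%N :> nat
| LabelAC3 (t : 'I_l) (t2 : 'I_g) of w = (u + t)%N :> nat &
    t2 != v & t2 = (j + t)%N :> nat & w = outer n v t2 :> nat.

Lemma parallel_labelP w : parallel_label_spec w.
Proof.
have hu' : nat_of_ord u = (j + n).-1 by rewrite hu /outer; case: ifP; lia.
have hv' : nat_of_ord v = i by rewrite hv /outer hij.
case: (originP e4 v w) => [t2 ht2 Et2|t Et].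
- case: (originP e3 j t2) => [t htj Et|t Et].
  + have hti : t != i.
      apply/negP => /eqP E; case/negP: ht2; apply/eqP/val_inj.
      by rewrite /= Et E hv.
    have := ord_neq htj; have := ord_neq hti; have := ord_neq ht2 => h1 h2 h3.
    apply: (@LabelAC1 w t (outer_label e1 hti) t2) => //=.
      apply/negP => /eqP/(congr1 val) /=.
      by rewrite hu' /outer; case: ifP; lia.
    move: h1; rewrite Et2 Et hv' hu' /= /outer.
    by do ![case: ifP]; lia.
  + apply: (@LabelAC3 w t t2) => //; rewrite Et2 hu' hv' Et /outer.
    by case: ifP; lia.
- apply: (@LabelAC2 w t (inner_label e1 i t)) => //=.
    apply/negP => /eqP/(congr1 val) /=; rewrite hu'; have := ltn_ord t; lia.
  by rewrite Et hu' hv' /outer; have := ltn_ord t; case: ifP; lia.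
Qed.
End ParallelLabels.

Lemma same_images_compA m n l k g h
    (e1 : (m + n)%N = k.+1) (e2 : (k + l)%N = h.+1)
    (e3 : (n + l)%N = g.+1) (e4 : (m + g)%N = h.+1)
    (p q r a b c : int) (f1 : p + q = a) (f2 : a + r = c)
    (f3 : q + r = b) (f4 : p + b = c)
    (i : 'I_m) (j : 'I_n) (u : 'I_k)
    (x : term lambda_sig m p) (y : term lambda_sig n q) (z : term lambda_sig l r) :
    u = (i + j)%N :> nat ->
    same_images (TComp e2 f2 u (TComp e1 f1 i x y) z)
        (TComp e4 f4 i x (TComp e3 f3 j y z)).
Proof.
move=> hu; split; first by apply/clsP; exact: teq_compA.
- move=> w.
  case: (assoc_labelP e1 e2 e3 e4 hu w) => [v v1 h1 h2 h3 h4 h5|v v1 v2 h1 h2 h3 h4 h5 h6|v v2 h1 h2 h3].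
  + rewrite (proj_out _ _ _ _ h1 h2) (proj_out _ _ _ _ h3 h5) (proj_out _ _ _ _ h1 h4).
    by rewrite -pcompE; exact: pcompA.
  + rewrite (proj_in _ _ _ _ h1) (proj_out _ _ _ _ h2 h3) (proj_out _ _ _ _ h4 h6).
    by rewrite (proj_in _ _ _ _ h5); exact: pcompA.
  + rewrite (proj_in _ _ _ _ h1) (proj_in _ _ _ _ h2) (proj_in _ _ _ _ h3).
    by rewrite (proj_in _ _ _ _ hu); exact: pcompA.
- have oa : oddz a = oddz p (+) oddz q by rewrite -f1 oddzD.
  move=> w.
  case: (assoc_labelP e1 e2 e3 e4 hu w) => [v v1 h1 h2 h3 h4 h5|v v1 v2 h1 h2 h3 h4 h5 h6|v v2 h1 h2 h3].
  + rewrite (homot_out _ _ _ _ h1 h2) (homot_out _ _ _ _ h3 h5) (homot_out _ _ _ _ h1 h4).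
    by rewrite -pcompE; exact: pcompA.
  + rewrite (homot_in _ _ _ _ h1) (homot_out _ _ _ _ h2 h3) (proj_out _ _ _ _ h2 h3).
    rewrite (homot_out _ _ _ _ h4 h6) (homot_in _ _ _ _ h5) pcompDl pcompSl.
    by congr (signed _ _ + _); exact: pcompA.
  + rewrite (homot_in _ _ _ _ h1) (homot_in _ _ _ _ h2) (proj_in _ _ _ _ h2).
    rewrite (homot_in _ _ _ _ h3) (homot_in _ _ _ _ hu).
    rewrite pcompDr pcompSr signedD signed_signed pcompDl pcompSl -addrA oa -pcompE.
    by congr (signed _ _ + (signed _ _ + _)); exact: pcompA.
Qed.

Lemma same_images_compAC m n l k g h
    (e1 : (m + n)%N = k.+1) (e2 : (k + l)%N = h.+1)
    (e3 : (m + l)%N = g.+1) (e4 : (g + n)%N = h.+1)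
    (p q r a b c : int) (f1 : p + q = a) (f2 : a + r = c)
    (f3 : p + r = b) (f4 : b + q = c)
    (i j : 'I_m) (u : 'I_k) (v : 'I_g)
    (x : term lambda_sig m p) (y : term lambda_sig n q) (z : term lambda_sig l r) :
    (i < j)%N -> u = outer n i j :> nat -> v = outer l j i :> nat ->
    same_images (TComp e2 f2 u (TComp e1 f1 i x y) z)
        (TSigned (oddz q && oddz r)
           (TComp e4 f4 v (TComp e3 f3 j x z) y)).
Proof.
move=> hij hu hv; have oa : oddz a = oddz p (+) oddz q by rewrite -f1 oddzD.
have ob : oddz b = oddz p (+) oddz r by rewrite -f3 oddzD.
have nij : i != j by apply/eqP => E; rewrite E ltnn in hij.
have nji : j != i by rewrite eq_sym.
have ac : forall (p q r a b c : int) (f1 : p + q = a) (f2 : a + r = c)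
    (f3 : p + r = b) (f4 : b + q = c) (x : PLambda m p) (y : PLambda n q) (z : PLambda l r),
    pcomp e2 f2 u (pcomp e1 f1 i x y) z =
    signed (oddz q && oddz r) (pcomp e4 f4 v (pcomp e3 f3 j x z) y).
  by move=> *; exact: pcompAC.
split; first by apply/clsP; exact: teq_compAC.
- move=> w; rewrite proj_TSigned.
  case: (parallel_labelP e1 e2 e3 e4 hij hu hv w)
      => [t t1 t2 h1 h2 h3 h4 h5 h6 h7 h8|t t1 h1 h2 h3 h4|t t2 h1 h2 h3 h4].
  + rewrite (proj_out _ _ _ _ h3 h5) (proj_out _ _ _ _ h1 h4).
    by rewrite (proj_out _ _ _ _ h6 h8) (proj_out _ _ _ _ h2 h7); exact: ac.
  + rewrite (proj_out _ _ _ _ h1 h3) (proj_in _ _ _ _ h2).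
    by rewrite (proj_in _ _ _ _ h4) (proj_out _ _ _ _ nij hv); exact: ac.
  + rewrite (proj_in _ _ _ _ h1) (proj_out _ _ _ _ nji hu).
    by rewrite (proj_out _ _ _ _ h2 h4) (proj_in _ _ _ _ h3); exact: ac.
- move=> w; rewrite homot_TSigned.
  case: (parallel_labelP e1 e2 e3 e4 hij hu hv w)
      => [t t1 t2 h1 h2 h3 h4 h5 h6 h7 h8|t t1 h1 h2 h3 h4|t t2 h1 h2 h3 h4].
  + rewrite (homot_out _ _ _ _ h3 h5) (homot_out _ _ _ _ h1 h4).
    by rewrite (homot_out _ _ _ _ h6 h8) (homot_out _ _ _ _ h2 h7); exact: ac.
  + rewrite (homot_out _ _ _ _ h1 h3) (homot_in _ _ _ _ h2).
    rewrite (homot_in _ _ _ _ h4) (homot_out _ _ _ _ nij hv) pcompDl pcompSl.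
    rewrite signedD signed_signed -pcompE; congr (_ + _); last exact: ac.
    rewrite (ac _ _ _ _ _ _ _ _ (f3) (degree_Pr f4)) signed_signed oddzB1 ob.
    by congr signed; case: (oddz p); case: (oddz q); case: (oddz r).
  + rewrite (homot_in _ _ _ _ h1) (homot_out _ _ _ _ nji hu).
    rewrite (homot_out _ _ _ _ h2 h4) (homot_in _ _ _ _ h3) pcompDl pcompSl.
    rewrite signedD signed_signed -pcompE; congr (_ + _); last exact: ac.
    rewrite (ac _ _ _ _ _ _ _ _ (degree_Pr f3) (degree_Pl f4)) signed_signed oddzB1 oa.
    by congr signed; case: (oddz p); case: (oddz q); case: (oddz r).
Qed.

(** Both operators are defined on Lambda.  The three conclusions are proved together because
the clause of homot for a composite involves the class and the projection of the factors. *)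
Lemma teq_images n p (x y : term lambda_sig n p) : teq lambda_rel x y -> same_images x y.
Proof.
elim=> {n p x y}.
- move=> n p x y h; split; first exact/clsP/teq_rel.
  + exact: proj_rel.
  + exact: homot_rel.
- by [].
- by move=> n p x y _ [h1 h2 h3]; split.
- move=> n p x y z _ [h1 h2 h3] _ [g1 g2 g3]; split; first by rewrite h1.
  + by move=> l; rewrite h2.
  + by move=> l; rewrite h3.
- move=> n p s x y _ [h1 h2 h3]; split; first by rewrite -!pactE h1.
  + by move=> l /=; rewrite h2.
  + by move=> l /=; rewrite h3.
- move=> m n k e p q r f i x x' y y' _ [h1 h2 h3] _ [g1 g2 g3].
  split; first by rewrite -!pcompE h1 g1.
  + by move=> l /=; case: origin => j; rewrite ?h2 ?g1 ?g2.
  + by move=> l /=; case: origin => j; rewrite ?h1 ?h3 ?g1 ?g2 ?g3.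
- move=> n p x y _ [h1 h2 h3]; split; first by rewrite !clsN h1.
  + by move=> l /=; rewrite h2.
  + by move=> l /=; rewrite h3.
- move=> n p x x' y y' _ [h1 h2 h3] _ [g1 g2 g3].
  split; first by rewrite !clsD h1 g1.
  + by move=> l /=; rewrite h2 g2.
  + by move=> l /=; rewrite h3 g3.
- move=> n p x y z; split=> [|l|l] /=; rewrite ?clsD; exact: addrA.
- move=> n p x y; split=> [|l|l] /=; rewrite ?clsD; exact: addrC.
- move=> n p x; split=> [|l|l] /=; rewrite ?clsD; exact: add0r.
- move=> n p x; split=> [|l|l] /=; rewrite ?clsD ?clsN; exact: addNr.
- by move=> n p s x y; split=> [|l|l] /=; [exact/clsP/teq_actD|exact: pactD|exact: pactD].
- move=> m n k e p q r f i x y z; split=> [|l|l] /=; first exact/clsP/teq_compDl.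
  + by case: origin => j; exact: pcompDl.
  + case: origin => j; first exact: pcompDl.
    by rewrite clsD !pcompDl signedD addrACA.
- move=> m n k e p q r f i x y z; split=> [|l|l] /=; first exact/clsP/teq_compDr.
  + by case: origin => j; rewrite ?clsD; exact: pcompDr.
  + case: origin => j; first by rewrite clsD pcompDr.
    by rewrite !pcompDr signedD addrACA.
- move=> n p x; split=> [|l|l] /=; first exact/clsP/teq_act1.
  + by rewrite invg1 perm1 pact1.
  + by rewrite invg1 perm1 pact1.
- move=> n p s t x; split=> [|l|l] /=; first exact/clsP/teq_actM.
  + by rewrite invMg permM pactM.
  + by rewrite invMg permM pactM.
- by move=> *; exact: same_images_act.
- move=> n e p f i x; split=> [|l|l]; first exact/clsP/teq_comp1l.
  + have El : l = (i + l)%N :> nat by rewrite (ord1 i).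
    by rewrite (proj_in _ _ _ _ El); exact: pcomp1l.
  + have El : l = (i + l)%N :> nat by rewrite (ord1 i).
    by rewrite (homot_in _ _ _ _ El) /= pcomp0l addr0; exact: pcomp1l.
- move=> m e p f i x; split=> [|l|l]; first exact/clsP/teq_comp1r.
  + case: (eqVneq l i) => [->|h].
      have El : i = (i + @ord0 0)%N :> nat by rewrite addn0.
      by rewrite (proj_in _ _ _ _ El); exact: pcomp1r.
    have El : l = outer 1 i l :> nat by rewrite /outer; case: ifP => //; lia.
    by rewrite (proj_out _ _ _ _ h El); exact: pcomp1r.
  + case: (eqVneq l i) => [->|h].
      have El : i = (i + @ord0 0)%N :> nat by rewrite addn0.
      by rewrite (homot_in _ _ _ _ El) /= pcomp0r signed0 add0r; exact: pcomp1r.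
    have El : l = outer 1 i l :> nat by rewrite /outer; case: ifP => //; lia.
    by rewrite (homot_out _ _ _ _ h El); exact: pcomp1r.
- by move=> *; exact: same_images_compA.
- by move=> *; exact: same_images_compAC.
Qed.

(** * The homotopy formula *)

(** Transport along an equality of degrees: p - 1 + 1 and p + 1 - 1 are not
convertible to p. *)
Definition shift n p q (e : p = q) (x : PLambda n p) : PLambda n q := ecast q (PLambda n q) e x.

Lemma shift_id n p (e : p = p) (x : PLambda n p) : shift e x = x.
Proof. by rewrite /shift eq_axiomK. Qed.
Lemma shiftD n p q (e : p = q) (x y : PLambda n p) : shift e (x + y) = shift e x + shift e y.
Proof. by subst q. Qed.
Lemma shift0 n p q (e : p = q) : shift e (0 : PLambda n p) = 0.
Proof. by subst q. Qed.
Lemma shiftN n p q (e : p = q) (x : PLambda n p) : shift e (- x) = - shift e x.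
Proof. by subst q. Qed.
Lemma shift_signed n p q (e : p = q) b (x : PLambda n p) :
  shift e (signed b x) = signed b (shift e x).
Proof. by subst q. Qed.
Lemma shift_act n p q (e : p = q) s (x : PLambda n p) : shift e (pact s x) = pact s (shift e x).
Proof. by subst q. Qed.
Lemma shift_comp m n k (e : (m + n)%N = k.+1) (p q r r' : int) (f : p + q = r)
  (f' : p + q = r') (g : r = r') i (x : PLambda m p) (y : PLambda n q) :
  shift g (pcomp e f i x y) = pcomp e f' i x y.
Proof. by case: _ / g f' => f'; exact: pcomp_irr. Qed.
Lemma shift_compl m n k (e : (m + n)%N = k.+1) (p p' q r : int) (f : p + q = r)
  (f' : p' + q = r) (g : p = p') i (x : PLambda m p) (y : PLambda n q) :
  pcomp e f' i (shift g x) y = pcomp e f i x y.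
Proof. by subst p'; exact: pcomp_irr. Qed.
Lemma shift_compr m n k (e : (m + n)%N = k.+1) (p q q' r : int) (f : p + q = r)
  (f' : p + q' = r) (g : q = q') i (x : PLambda m p) (y : PLambda n q) :
  pcomp e f' i x (shift g y) = pcomp e f i x y.
Proof. by subst q'; exact: pcomp_irr. Qed.

(** Stating the differential on the presented groups, instead of the complex
Lambda n, gives it there the structure of an additive map. *)
Definition dl n p (x : PLambda n p) : PLambda n (p + 1) := pdiff lambda_diff x.
Lemma dl_act n p (s : 'S_n) (x : PLambda n p) : dl (pact s x) = pact s (dl x).
Proof. exact: (pdiff_act lambda_diff_rel). Qed.
Lemma dl_is_additive n p : {morph @dl n p : x y / x - y}.
Proof. exact: (pdiffB lambda_diff_rel). Qed.
HB.instance Definition _ n p :=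
  GRing.isZmodMorphism.Build (PLambda n p) (PLambda n (p + 1)) (@dl n p) (@dl_is_additive n p).
Lemma dlD n p (x y : PLambda n p) : dl (x + y) = dl x + dl y.
Proof. exact: raddfD. Qed.
Lemma dlN n p (x : PLambda n p) : dl (- x) = - dl x.
Proof. exact: raddfN. Qed.
Lemma dl0 n p : dl (0 : PLambda n p) = 0.
Proof. exact: raddf0. Qed.
Lemma dl_signed n p b (x : PLambda n p) : dl (signed b x) = signed b (dl x).
Proof. by case: b; rewrite //= dlN. Qed.

Lemma dl_comp m n k (e : (m + n)%N = k.+1) (p q r : int) (f : p + q = r)
  i (x : PLambda m p) (y : PLambda n q) :
  dl (pcomp e f i x y) = pcomp e (degree_Sl f) i (dl x) y +
     signed (oddz p) (pcomp e (degree_Sr f) i x (dl y)).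
Proof. exact: (pdiff_comp lambda_diff_rel). Qed.
Lemma dlE n p (x : term lambda_sig n p) : dl (lamc x) = lamc (tdiff lambda_diff x).
Proof. exact: (pdiffE lambda_diff_rel). Qed.

Lemma proj_diff n p (x : term lambda_sig n p) l :
  proj (tdiff lambda_diff x) l = dl (proj x l).
Proof.
elim: x l => {n p} /=.
- case=> /= l; rewrite ?dl0 //; case: eqP => _; rewrite ?dl0 //.
  by rewrite /lbr dlD dlN dl_act dlE /= lambda_symE subrr.
- by move=> l; rewrite dlE.
- by move=> n p s x IH l; rewrite IH dl_act.
- move=> m n k e p q r f i x IHx y IHy l; rewrite proj_TSigned /=.
  case: origin => j; rewrite dl_comp IHx ?IHy //; congr (_ + signed _ _).
  by rewrite dlE.
- by move=> n p l; rewrite dl0.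
- by move=> n p x IH l; rewrite IH dlN.
- by move=> n p x IHx y IHy l; rewrite IHx IHy dlD.
Qed.

Lemma signed_negb (U : zmodType) b (x : U) : signed (~~ b) x = - signed b x.
Proof. by case: b; rewrite //= opprK. Qed.

(** The cancellation in d homot + homot d on a composite, for a label of the
inner factor: s is dx o homot y and v is homot x o d (proj y). *)
Lemma signed_cancel (U : zmodType) b (s t u v w z : U) :
  signed b (s + signed b t) + (u + signed (~~ b) v) +
  (signed (~~ b) s + w + signed b (signed b z + v)) = t + z + (u + w).
Proof.
rewrite !signedD !signed_signed addbb !signed_negb /=.
by rewrite (AC ((2*2)*(2*2)) ((1*5)*(4*8)*((2*7)*(3*6)))) /= subrr addNr !add0r.
Qed.

(** On a composite with label in the inner factor, the two sides are
x o (y - proj y) + (x - proj x) o proj y and x o y - proj x o proj y. *)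
Lemma homotopy n p (x : term lambda_sig n p) l :
  shift (subrK 1 p) (dl (homot x l)) + shift (addrK 1 p) (homot (tdiff lambda_diff x) l)
  = lamc x - proj x l.
Proof.
elim: x l => {n p}.
- case; elim/ord2P; rewrite /= ?dl0 ?dl_act ?shift0 ?add0r ?addr0 ?dlE ?shift_act ?shift_id.
  + by rewrite /lbr opprB addrC subrK.
  + by rewrite subr0.
  + by rewrite subr0 lambda_symE.
  + by rewrite subr0.
- by move=> l; rewrite /= dl0 !shift0 addr0 subrr.
- move=> n p s x IH l.
  by rewrite /= dl_act !shift_act -pactD IH pactB pactE.
- move=> m n k e p q r f i x IHx y IHy l.
  have fl : p - 1 + 1 + q = r by rewrite subrK.
  have fr : p + (q - 1 + 1) = r by rewrite subrK.
  have fl' : p + 1 - 1 + q = r by rewrite addrK.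
  have fr' : p + (q + 1 - 1) = r by rewrite addrK.
  have fm : p - 1 + (q + 1) = r by rewrite addrA addrAC subrK.
  have fm' : p + 1 + (q - 1) = r by rewrite addrA addrAC addrK.
  rewrite /= homot_TSigned /=; case: origin => j.
  + rewrite dl_comp !shiftD !shift_signed !(shift_comp _ _ fl) !(shift_comp _ _ fm).
    rewrite (shift_comp _ _ fl') -dlE oddzB1.
    rewrite -(shift_compl _ fl f (subrK 1 p)) -(shift_compl _ fl' f (addrK 1 p)).
    by rewrite addrACA -pcompDl IHx signed_negb addNr addr0 pcompDl pcompNl pcompE.
  + rewrite !(shiftD, dlD, shift_signed, dl_signed, dl_comp, signedD, proj_diff) -dlE.
    rewrite !(shift_comp _ _ fl) !(shift_comp _ _ fr) !(shift_comp _ _ fm).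
    rewrite !(shift_comp _ _ fl') !(shift_comp _ _ fr') !(shift_comp _ _ fm').
    rewrite -(shift_compl _ fl f (subrK 1 p)) -(shift_compl _ fl' f (addrK 1 p)).
    rewrite -(shift_compr _ fr f (subrK 1 q)) -(shift_compr _ fr' f (addrK 1 q)).
    rewrite oddzB1 oddz1 -!signedD signed_cancel.
    rewrite -pcompDl -pcompDr IHx IHy.
    by rewrite pcompDl pcompDr pcompNl pcompNr addrA subrK pcompE.
- by move=> n p l; rewrite /= dl0 !shift0 addr0 subrr.
- by move=> n p x IH l; rewrite /= dlN !shiftN -opprD IH clsN opprB opprK addrC.
- move=> n p x IHx y IHy l; rewrite /= dlD !shiftD clsD opprD.
  by rewrite addrACA IHx IHy addrACA.
Qed.

(** * Morphisms out of a presented operad *)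

Section Universal.
Variables (G : signature) (R : forall n p, term G n p -> term G n p -> Prop).
Variable dgen : forall g : G, term G (gen_arity g) (gen_degree g + 1).
Hypothesis dgen_rel :
  forall n p (x y : term G n p), R x y -> teq R (tdiff dgen x) (tdiff dgen y).
Hypothesis dgen_dgen : forall g, teq R (tdiff dgen (dgen g)) TZero.
Variables (Q : dgOperad) (phi : forall g : G, Q (gen_arity g) (gen_degree g)).

Fixpoint interp n p (x : term G n p) : Q n p :=
  match x with
  | TGen g => phi g
  | TId => op1
  | TAct n p s x => opact s (interp x)
  | TComp m n k e p q r f i x y => opcomp e f i (interp x) (interp y)
  | TZero n p => 0
  | TOpp n p x => - interp x
  | TAdd n p x y => interp x + interp y
  end.

Hypothesis phi_rel : forall n p (x y : term G n p), R x y -> interp x = interp y.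
Hypothesis phi_diff : forall g, interp (dgen g) = cdiff (phi g).

Lemma interp_TSigned n p b (x : term G n p) : interp (TSigned b x) = signed b (interp x).
Proof. by case: b. Qed.

Lemma interp_teq n p (x y : term G n p) : teq R x y -> interp x = interp y.
Proof.
elim=> {n p x y} //=.
- by move=> n p x y z _ -> _ ->.
- by move=> n p s x x' _ ->.
- by move=> m n k e p q r f i x x' y y' _ -> _ ->.
- by move=> n p x x' _ ->.
- by move=> n p x x' y y' _ -> _ ->.
- by move=> *; exact: addrA.
- by move=> *; exact: addrC.
- by move=> *; exact: add0r.
- by move=> *; exact: addNr.
- by move=> *; exact: raddfD.
- by move=> *; exact: opcompDl.
- by move=> *; exact: opcompDr.
- by move=> *; exact: opact1.
- by move=> *; exact: opactM.
- by move=> *; exact: opcomp_act.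
- by move=> *; exact: opcomp1l.
- by move=> *; exact: opcomp1r.
- by move=> *; exact: opcompA.
- by move=> *; rewrite interp_TSigned; exact: opcompAC.
Qed.

Definition interp_cls n p (x : presented R n p) : Q n p := interp (repr x).

Lemma interp_clsE n p (x : term G n p) : interp_cls (cls R x) = interp x.
Proof. by apply/interp_teq/teq_repr. Qed.

Lemma interp_clsB n p : {morph @interp_cls n p : x y / x - y}.
Proof.
move=> x y; have [[a ->] [b ->]] := (cls_surj x, cls_surj y).
by rewrite -clsN -clsD !interp_clsE.
Qed.

HB.instance Definition _ n p :=
  GRing.isZmodMorphism.Build (presented R n p) (Q n p)
    (@interp_cls n p) (@interp_clsB n p).

Lemma interp_diff n p (x : term G n p) :
  interp (tdiff dgen x) = cdiff (interp x).
Proof.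
elim: x => {n p} //=.
- by rewrite opdiff1.
- by move=> n p s x ->; rewrite opdiff_act.
- move=> m n k e p q r f i x IHx y IHy; rewrite interp_TSigned /= IHx IHy.
  by rewrite -opdiff_comp.
- by move=> n p; rewrite raddf0.
- by move=> n p x ->; rewrite raddfN.
- by move=> n p x -> y ->; rewrite raddfD.
Qed.

Lemma interp_cls_diff n p (x : presented R n p) :
  interp_cls (pdiff dgen x) = cdiff (interp_cls x).
Proof.
by have [t ->] := cls_surj x; rewrite (pdiffE dgen_rel) !interp_clsE interp_diff.
Qed.

Let PO := presented_operad dgen_rel dgen_dgen.

Definition interp_chain n : chainMap (PO n) (Q n) :=
  @ChainMap (PO n) (Q n) (fun p => @interp_cls n p) (@interp_cls_diff n).

Lemma interp_act n p (s : 'S_n) (x : presented R n p) :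
  interp_cls (pact s x) = opact s (interp_cls x).
Proof. by have [t ->] := cls_surj x; rewrite pactE !interp_clsE. Qed.

Lemma interp_comp m n k (e : (m + n)%N = k.+1) (p q r : int) (f : p + q = r)
    (i : 'I_m) (x : presented R m p) (y : presented R n q) :
  interp_cls (pcomp e f i x y) = opcomp e f i (interp_cls x) (interp_cls y).
Proof.
have [[a ->] [b ->]] := (cls_surj x, cls_surj y).
by rewrite pcompE !interp_clsE.
Qed.

Definition presented_morphism : dgMorphism PO Q :=
  @DGMorphism PO Q interp_chain (interp_clsE TId) interp_act interp_comp.

(** Terms are built from the generators by the operations of an operad. *)
Lemma presented_morphism_uniq (g : dgMorphism PO Q) :
  (forall a, g _ _ (cls R (TGen a)) = phi a) ->
  forall n p (x : PO n p), g n p x = presented_morphism n p x.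
Proof.
move=> hg n p x; have [t ->] := cls_surj x.
rewrite [RHS]interp_clsE; elim: t => {n p x} /=.
- exact: hg.
- exact: (opfun1 g).
- by move=> n p s x <-; rewrite -pactE; exact: (opfun_act g).
- by move=> m n k e p q r f i x <- y <-; rewrite -pcompE; exact: (opfun_comp g).
- by move=> n p; exact: raddf0.
- by move=> n p x <-; rewrite clsN; exact: raddfN.
- by move=> n p x <- y <-; rewrite clsD; exact: raddfD.
Qed.
End Universal.

Definition lie_phi (g : lie_sig) : Lambda (gen_arity g) (gen_degree g) := lbr.

Lemma lie_phi_rel n p (x y : term lie_sig n p) :
  lie_rel x y -> interp lie_phi x = interp lie_phi y.
Proof.
case=> {n p x y} /=; first exact: lbr_antisym.
have := lbr_jacobi; rewrite /cyc pactM => E; exact: E.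
Qed.

Lemma lie_phi_diff g : interp lie_phi (lie_diff g) = cdiff (lie_phi g).
Proof.
rewrite /= -[RHS]/(dl lbr) /lbr dlD dlN dl_act dlE /= lambda_symE.
by rewrite subrr.
Qed.

Definition lie_to_lambda : dgMorphism Lie Lambda :=
  presented_morphism lie_diff_rel lie_diff_diff lie_phi_rel lie_phi_diff.

Lemma lie_to_lambdaE : lie_to_lambda 2%N 0 lie_bracket = lbr.
Proof. exact: (interp_clsE lie_phi_rel lie_gen). Qed.

(** * Successive projections land in the image of Lie *)

(** lieish S x holds if x is an expression in which the labels of S are reached
from the root through the bracket lbr only.  The rule for composites asks, for
a label of S in the inner factor, that the place of this factor be reached in
the same way in the outer one.  With S empty nothing is asked. *)
Inductive lieish : forall n p, ('I_n -> Prop) -> PLambda n p -> Prop :=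
| li_any n p (S : 'I_n -> Prop) (x : PLambda n p) : (forall l, ~ S l) -> lieish S x
| li_id (S : 'I_1 -> Prop) : lieish S (lamc TId)
| li_bracket (S : 'I_2 -> Prop) : lieish S lbr
| li_act n p (S T : 'I_n -> Prop) (s : 'S_n) (x : PLambda n p) : (forall l, T (s l) -> S l) ->
    lieish S x -> lieish T (pact s x)
| li_comp m n k (e : (m + n)%N = k.+1) (p q r : int) (f : p + q = r) (i : 'I_m)
    (S : 'I_m -> Prop) (T : 'I_n -> Prop) (U : 'I_k -> Prop)
    (x : PLambda m p) (y : PLambda n q) : lieish S x -> lieish T y ->
    (forall (j : 'I_m) (l : 'I_k), j != i -> l = outer n i j :> nat -> U l -> S j) ->
    (forall (j : 'I_n) (l : 'I_k), l = (i + j)%N :> nat -> U l -> S i /\ T j) ->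
    lieish U (pcomp e f i x y)
| li_zero n p (S : 'I_n -> Prop) : lieish S (0 : PLambda n p)
| li_opp n p (S : 'I_n -> Prop) (x : PLambda n p) : lieish S x -> lieish S (- x)
| li_add n p (S : 'I_n -> Prop) (x y : PLambda n p) :
    lieish S x -> lieish S y -> lieish S (x + y).

Lemma lieish_sub n p (S T : 'I_n -> Prop) (x : PLambda n p) :
  (forall l, T l -> S l) -> lieish S x -> lieish T x.
Proof.
move=> h H; elim: H T h => {n p S x}.
- by move=> n p S x hS T h; apply: li_any => l /h; exact: hS.
- by move=> *; exact: li_id.
- by move=> *; exact: li_bracket.
- move=> n p S T s x hS hx _ T' h; apply: li_act hx => l /h; exact: hS.
- move=> m n k e p q r f i S T U x y hx _ hy _ h1 h2 U' h.
  apply: (li_comp _ _ hx hy) => j l; first by move=> hj E /h; exact: h1.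
  by move=> E /h; exact: h2.
- by move=> *; exact: li_zero.
- by move=> n p S x _ IH T h; apply/li_opp/IH.
- by move=> n p S x y _ IHx _ IHy T h; apply: li_add; [exact: IHx|exact: IHy].
Qed.

Lemma inl_inj (B A : Type) : injective (@inl A B).
Proof. by move=> a b []. Qed.

(** By the rule for composites, proj (x o_i y) involves x with i under
brackets only and y with l under brackets only. *)
Lemma lieish_proj n p (x : term lambda_sig n p) l :
  lieish (fun l' => l' = l) (proj x l).
Proof.
elim: x l => {n p} /=.
- case=> /= l; first by case: ifP => _; [exact: li_bracket|exact: li_zero].
  exact: li_zero.
- by move=> l; exact: li_id.
- move=> n p s x IH l; apply: li_act (IH _) => l' <-; by rewrite permK.
- move=> m n k e p q r f i x IHx y IHy l; case: (originP e i l) => j.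
  + move=> hj E.
    apply: (li_comp _ _ (IHx j) (@li_any _ _ (fun _ => False) (lamc y) _)).
    * by move=> ? [].
    * by move=> j' l' hj' E' El; apply: (@inl_inj 'I_n);
         rewrite -(origin_out e hj' E') -(origin_out e hj E) El.
    * by move=> j' l' E' El; have := origin_in E'; rewrite El (origin_out e hj E).
  + move=> E; apply: (li_comp _ _ (IHx i) (IHy j)).
    * by move=> j' l' hj' E' El; have := origin_out e hj' E'; rewrite El (origin_in E).
    * move=> j' l' E' El; split=> //; apply/val_inj/eqP.
      by rewrite -(eqn_add2l i) -E -E' El.
- by move=> *; exact: li_zero.
- by move=> n p x IH l; exact/li_opp.
- by move=> n p x IHx y IHy l; exact: li_add.
Qed.

Definition projc n p (x : PLambda n p) l : PLambda n p := proj (repr x) l.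

Lemma projcE n p (x : term lambda_sig n p) l : projc (lamc x) l = proj x l.
Proof. by have [_ h _] := teq_images (teq_repr lambda_rel x); exact: h. Qed.

Lemma projcN n p (x : PLambda n p) l : projc (- x) l = - projc x l.
Proof. by have [t ->] := cls_surj x; rewrite -clsN !projcE. Qed.
Lemma projcD n p (x y : PLambda n p) l : projc (x + y) l = projc x l + projc y l.
Proof.
by have [[a ->] [b ->]] := (cls_surj x, cls_surj y); rewrite -clsD !projcE.
Qed.

Lemma projc_act n p s (x : PLambda n p) l : projc (pact s x) l = pact s (projc x (s^-1%g l)).
Proof. by have [t ->] := cls_surj x; rewrite pactE !projcE. Qed.

Lemma projc_lbr l : projc lbr l = lbr.
Proof.
rewrite {1}/lbr projcD projcN projc_act !projcE /=.
elim/ord2P: l; rewrite swap12V /= ?pact0 ?subr0 //.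
by rewrite lbr_antisym sub0r opprK.
Qed.

(** Brackets are preserved, since lbr is its own projection on either label,
and lieish_proj brings the label l under brackets in the remaining places. *)
Lemma lieish_projc n p (S : 'I_n -> Prop) (x : PLambda n p) l :
  lieish S x -> lieish (fun l' => S l' \/ l' = l) (projc x l).
Proof.
move=> H; elim: H l => {n p S x}.
- move=> n p S x hS l; have [t ->] := cls_surj x; rewrite projcE.
  by apply: lieish_sub (lieish_proj t l) => l' [/hS|].
- by move=> S l; rewrite projcE; exact: li_id.
- by move=> S l; rewrite projc_lbr; exact: li_bracket.
- move=> n p S T s x hS _ IH l; rewrite projc_act; apply: li_act (IH _) => l'.
  by case=> [/hS|<-]; [left|right; rewrite permK].
- move=> m n k e p q r f i S T U x y hx IHx hy IHy hS hT l.
  have [[a Ea] [b Eb]] := (cls_surj x, cls_surj y).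
  rewrite Ea Eb pcompE projcE /=; case: (originP e i l) => j.
  + move=> hj E; rewrite -projcE -Ea -Eb; apply: (li_comp _ _ (IHx j) hy).
      move=> j' l' hj' E' [|El]; first by left; exact: hS E' _.
      right; apply: (@inl_inj 'I_n).
      by rewrite -(origin_out e hj' E') -(origin_out e hj E) El.
    move=> j' l' E' [/(hT j' l' E') [] //|El]; first by split=> //; left.
    by have := origin_in E'; rewrite El (origin_out e hj E).
  + move=> E; rewrite -!projcE -Ea -Eb; apply: (li_comp _ _ (IHx i) (IHy j)).
      move=> j' l' hj' E' [|El]; first by left; exact: hS E' _.
      by have := origin_out e hj' E'; rewrite El (origin_in E).
    move=> j' l' E' [/(hT j' l' E') [] //|El]; first by split; left.
    split; right=> //; apply/val_inj/eqP.
    by rewrite -(eqn_add2l i) -E -E' El.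
- by move=> n p S l; rewrite (projcE TZero); exact: li_zero.
- by move=> n p S x _ IH l; rewrite projcN; exact/li_opp.
- by move=> n p S x y _ IHx _ IHy l; rewrite projcD; exact: li_add.
Qed.

Lemma presented_arity0 (G : signature)
  (R : forall n p, term G n p -> term G n p -> Prop) p (x : presented R 0 p) :
  (forall g : G, gen_arity g <> 0%N) -> x = 0.
Proof.
move=> hG; have [t ->] := cls_surj x.
have gen n q (y : term G n q) : n = 0%N -> cls R y = 0.
  elim: y => {n q} //=.
  - by move=> g /hG.
  - by move=> n q s y IH /IH h; rewrite -pactE h pact0.
  - move=> m n k e a b c f i y _ z IH k0.
    rewrite -pcompE IH ?pcomp0r //; have := ltn_ord i; lia.
  - by move=> n q y IH /IH h; rewrite clsN h oppr0.
  - by move=> n q y IHy z IHz n0; rewrite clsD IHy // IHz // addr0.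
exact: gen.
Qed.

(** If all labels are reached through brackets, then the whole expression is
made of brackets.  A composite with an operation without inputs puts no
condition on the outer factor, but such operations are zero. *)
Lemma lieish_full n p (S : 'I_n -> Prop) (x : PLambda n p) :
  lieish S x -> (forall l, S l) -> exists z : Lie n p, lie_to_lambda n p z = x.
Proof.
elim=> {n p S x}.
- move=> n p S x hS full; exists 0; rewrite raddf0.
  case: n => [|n] in S x hS full *; first by rewrite [RHS]presented_arity0 //; case.
  by case: (hS ord0).
- by move=> S _; exists op1; exact: (opfun1 lie_to_lambda).
- by move=> S _; exists lie_bracket; exact: lie_to_lambdaE.
- move=> n p S T s x hS _ IH full.
  have [l|z <-] := IH; first exact: hS.
  by exists (opact s z); exact: (opfun_act lie_to_lambda).
- move=> m n k e p q r f i S T U x y _ IHx _ IHy hS hT full.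
  case: n => [|n] in e y T IHy hS hT *.
    by exists 0; rewrite raddf0 (presented_arity0 y) ?pcomp0r //; case.
  have [|z <-] := IHx.
    move=> j; case: (eqVneq j i) => [->|hj].
      by have [] := hT ord0 (inner_label e i ord0) erefl (full _).
    exact: (hS j (outer_label e hj) hj erefl (full _)).
  have [|w <-] := IHy.
    by move=> j; have [] := hT j (inner_label e i j) erefl (full _).
  by exists (opcomp e f i z w); exact: (opfun_comp lie_to_lambda).
- by move=> n p S _; exists 0; exact: raddf0.
- by move=> n p S x _ IH /IH [z <-]; exists (- z); exact: raddfN.
- move=> n p S x y _ IHx _ IHy full.
  have [[z <-] [w <-]] := (IHx full, IHy full).
  by exists (z + w); exact: raddfD.
Qed.

Lemma shift_coboundary n p q (e : p + 1 = q) (x : Lambda n p) :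
  coboundary (shift e (dl x) : Lambda n q).
Proof. by case: _ / e; exact: (Coboundary (C := Lambda n) x). Qed.

(** On a cocycle, the term homot d of the homotopy formula vanishes. *)
Lemma projc_cohomologous n p (x : PLambda n p) l : dl x = 0 ->
  dl (projc x l) = 0 /\ coboundary (x - projc x l : Lambda n p).
Proof.
have [t ->] := cls_surj x; rewrite dlE projcE => /clsP/teq_images [_ h1 h2].
split; first by rewrite -proj_diff h1.
by rewrite -homotopy h2 shift0 addr0; exact: shift_coboundary.
Qed.

(** The labels are projected one after the other. *)
Lemma lie_onto_cohomology n p (x : PLambda n p) : dl x = 0 ->
  exists z : Lie n p, coboundary (x - lie_to_lambda n p z : Lambda n p).
Proof.
move=> hx.
have gen k : exists y : PLambda n p, [/\ dl y = 0, coboundary (x - y : Lambda n p)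
    & lieish (fun l : 'I_n => (l < k)%N) y].
  elim: k => [|k [y [h1 h2 h3]]].
    by exists x; split; rewrite ?subrr; [|exact: coboundary0|apply: li_any].
  case: (ltnP k n) => hk; last first.
    exists y; split=> //; apply: lieish_sub h3 => l _; exact: leq_trans hk.
  have [h4 h5] := projc_cohomologous (Ordinal hk) h1.
  exists (projc y (Ordinal hk)); split=> //.
    rewrite -(subrK y x) -addrA -[y - _]opprK; apply: coboundaryB => //.
    by rewrite -sub0r; apply: coboundaryB h5; exact: coboundary0.
  apply: lieish_sub (lieish_projc _ h3) => l; rewrite ltnS leq_eqVlt.
  by case/orP=> [/eqP E|]; [right; exact: val_inj|left].
have [y [_ h2 /lieish_full[l|z E]]] := gen n; first exact: ltn_ord.
by exists z; rewrite E.
Qed.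

(** * Left-normed words span Lie *)

Local Notation PLie := (presented lie_rel).
Local Notation liec := (cls lie_rel).
Local Notation br := (cls lie_rel lie_gen).

Lemma lie_antisymE : pact swap12 br = - br.
Proof. by rewrite pactE -clsN; apply/clsP/teq_rel; exact: lie_antisym. Qed.

Lemma lie_jacobiE : cmp o1 br br = pact swap23 (cmp o1 br br) + cmp o2 br br.
Proof.
apply: jacobi_cmp2; first exact: lie_antisymE.
rewrite /cyc pactM /cmp !(pcompE, pactE) -!clsD.
by apply/clsP/teq_rel; exact: lie_jacobi.
Qed.

(** lnorm i x: x is a combination of relabelled left-normed words whose first
letter is the label i. *)
Inductive lnorm : forall n p, 'I_n -> PLie n p -> Prop :=
| ln_id (i : 'I_1) : lnorm i (liec TId)
| ln_act n p (s : 'S_n) i (x : PLie n p) : lnorm i x -> lnorm (s i) (pact s x)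
| ln_step n k (e : (2 + n)%N = k.+1) p (f : 0 + p = p) (i : 'I_n) (j : 'I_k)
    (x : PLie n p) : j = i :> nat -> lnorm i x -> lnorm j (pcomp e f o1 br x)
| ln_zero n p (i : 'I_n) : lnorm i (0 : PLie n p)
| ln_opp n p i (x : PLie n p) : lnorm i x -> lnorm i (- x)
| ln_add n p i (x y : PLie n p) : lnorm i x -> lnorm i y -> lnorm i (x + y).

(** Substituting for the first letter of a left-normed word another
left-normed word yields a left-normed word. *)
Lemma lnorm_inner m n k (e : (m + n)%N = k.+1) (p q r : int) (f : p + q = r)
    (i : 'I_m) (j : 'I_n) (l : 'I_k) (x : PLie m p) (y : PLie n q) :
  lnorm i x -> lnorm j y -> l = (i + j)%N :> nat -> lnorm l (pcomp e f i x y).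
Proof.
move=> H; elim: H k e r f l => {m p i x}.
- move=> i k e r f l hy El.
  have ek : n = k by lia.
  have er : q = r by rewrite -f add0r.
  subst k; case: _ / er f => f; rewrite (pcomp1l e f).
  by have -> : l = j by apply/val_inj; rewrite /= El (ord1 i).
- move=> m p s i x _ IH k e r f l hy El.
  have [u hu] := block_perm_exists e i s 1%g.
  rewrite -[y]pact1 (pcomp_act _ _ _ _ hu).
  have -> : l = u (inner_label e i j).
    by apply/val_inj; rewrite /= El (hu.2 j (inner_label e i j) erefl) perm1.
  exact/ln_act/IH.
- move=> m k0 e0 p f0 i i' x Ei _ IH k e r f l hy El.
  have e3 : (m + n)%N = (m + n).-1.+1 by have := ltn_ord i; lia.
  have e4 : (2 + (m + n).-1)%N = k.+1 by lia.
  rewrite (pcompA (i := o1) (j := i) e0 e e3 e4 f0 f f (add0r r)) //.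
  apply: (ln_step (i := inner_label e3 i j) _ _); first by rewrite El Ei.
  exact: IH.
- by move=> m p i k e r f l _ _; rewrite pcomp0l; exact: ln_zero.
- by move=> m p i x _ IH k e r f l hy El; rewrite pcompNl; exact/ln_opp/IH.
- move=> m p i x x' _ IH _ IH' k e r f l hy El; rewrite pcompDl.
  by apply: ln_add; [exact: IH|exact: IH'].
Qed.

(** Stability of left-normed combinations under the substitution of y for a
letter other than the first one.  By associativity this property is inherited
by composites, which reduces it to the case of the bracket. *)
Definition lnorm_stable n q (y : PLie n q) := forall m k (e : (m + n)%N = k.+1)
  (p r : int) (f : p + q = r) (i j : 'I_m) (l : 'I_k) (z : PLie m p),
  lnorm j z -> j != i -> l = outer n i j :> nat -> lnorm l (pcomp e f i z y).

(** Going down to the letter i, the only case that is not formal is that of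
the last letter, where [w, [x, y]] = [[w, x], y] - [[w, y], x]. *)
Lemma lnorm_stable_br : lnorm_stable br.
Proof.
move=> m k e p r f i j l z H; elim: H k e r f i l => {m p j z}.
- by move=> j k e r f i l; rewrite (ord1 i) (ord1 j).
- move=> m p s j z _ IH k e r f i' l; rewrite -(permKV s i').
  move: (_ i') => i; rewrite (inj_eq perm_inj) => hj El.
  have [u hu] := block_perm_exists e i s (1%g : 'S_2).
  rewrite -[br]pact1 (pcomp_act _ _ _ _ hu).
  have -> : l = u (outer_label e hj).
    by apply/val_inj; rewrite /= El (hu.1 j (outer_label e hj) hj erefl).
  by apply/ln_act/IH.
- move=> m k0 e0 p f0 j j' z Ej hz IH k e r f i l hj El.
  have er : p = r by rewrite -f addr0.
  case: _ / er f => f; case: (ltnP i m) => him.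
    pose i0 := Ordinal him.
    have hj0 : j != i0.
      by apply/eqP => E; move: (ord_neq hj); rewrite Ej E.
    have e3 : (m + 2)%N = m.+1.+1 by lia.
    have e4 : (2 + m.+1)%N = k.+1 by lia.
    rewrite (pcompA (i := o1) (j := i0) e0 e e3 e4 f0 f f f0) //.
    apply: (ln_step (i := outer_label e3 hj0) _ _); last exact: IH.
    by rewrite El Ej.
  have Ei : i = m :> nat by have := ltn_ord i; lia.
  have Eu : i = outer m o1 o2 :> nat by rewrite Ei.
  have e3 : (2 + 2)%N = 4%N by [].
  have e4 : (3 + m)%N = k.+1 by lia.
  rewrite (pcompAC (i := o1) (j := o2) (v := @Ordinal 3 0 isT) e0 e e3 e4 f0 f (addr0 0) f0 br z br isT Eu erefl).
  rewrite andbF /=.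
  have El' : l = j :> nat by rewrite El Ej /outer Ei ltn_ord.
  have -> : pcomp e3 (addr0 0) o2 br br = cmp o1 br br - pact swap23 (cmp o1 br br).
    by rewrite {1}lie_jacobiE [X in X - _]addrC addrK; exact: pcomp_irr.
  rewrite pcompDl pcompNl.
  (* [[w, x], y], where w is z; the other term differs by swapping x and y. *)
  have hW : lnorm l (pcomp e4 f0 (@Ordinal 3 0 isT) (cmp o1 br br) z).
    have e5 : (2 + m)%N = m.+1.+1 by [].
    have e6 : (2 + m.+1)%N = k.+1 by lia.
    rewrite (pcompA (i := o1) (j := o1) _ e4 e5 e6 _ f0 f0 f0) //.
    apply: (ln_step (i := widen_ord (leqnSn m) j) _ _) => //.
    exact: (ln_step (i := j) _ _).
  apply: ln_add => //; apply: ln_opp.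
  have [u hu] := block_perm_exists e4 (@Ordinal 3 0 isT) swap23 (1%g : 'S_m).
  have Es : swap23 (@Ordinal 3 0 isT) = @Ordinal 3 0 isT by rewrite tpermD.
  rewrite -{1}Es -[z]pact1 (pcomp_act _ _ _ _ hu).
  have {1}-> : l = u l.
    by apply/val_inj; rewrite /= (hu.2 j l El') Es perm1 El'.
  exact: ln_act.
- by move=> m p i k e r f l l' _ _; rewrite pcomp0l; exact: ln_zero.
- by move=> m p i x _ IH k e r f l l' hy El; rewrite pcompNl; apply/ln_opp/IH.
- move=> m p i x x' _ IH _ IH' k e r f l l' hy El; rewrite pcompDl.
  by apply: ln_add; [exact: IH El|exact: IH' El].
Qed.

Lemma lnorm_all n p (x : term lie_sig n p) :
  (forall j, lnorm j (liec x)) /\ lnorm_stable (liec x).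
Proof.
elim: x => {n p}.
- case; split; last exact: lnorm_stable_br.
  have h1 : lnorm o1 br.
    rewrite -[br](pcomp1r (erefl : (2 + 1)%N = 3%N) (addr0 0) o1).
    apply: (@ln_step 1 2 erefl 0 (addr0 0) (@ord0 0) o1 (liec TId)) => //.
    exact: ln_id.
  elim/ord2P => //; rewrite -[X in lnorm _ X]opprK -[X in - X]lie_antisymE.
  have -> : o2 = swap12 o1 by rewrite tpermL.
  exact/ln_opp/ln_act.
- split=> [j|]; first exact: ln_id.
  move=> m k e p r f i j l z hz hj El.
  have ek : m = k by lia.
  have er : p = r by rewrite -f addr0.
  subst k; case: _ / er f => f; rewrite (pcomp1r e f).
  suff -> : l = j by [].
  by apply: val_inj; rewrite /= El /outer; case: ifP => //=; lia.
- move=> n q s x [h1 h2]; rewrite -pactE; split.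
    by move=> j; rewrite -(permKV s j); exact/ln_act.
  move=> m k e p r f i j l z hz hj El.
  have [u hu] := block_perm_exists e i 1%g s.
  rewrite -[z]pact1 -[i]perm1 (pcomp_act _ _ _ _ hu).
  have -> : l = u (outer_label e hj).
    by apply/val_inj; rewrite /= El (hu.1 j (outer_label e hj) hj erefl) !perm1.
  exact/ln_act/(h2 _ _ _ _ _ _ _ j).
- move=> m n k e p q r f i x [hx sx] y [hy sy]; rewrite -pcompE; split.
    move=> l; case: (originP e i l) => j; last exact: lnorm_inner.
    by move=> hj El; exact: (sy _ _ _ _ _ _ _ j).
  move=> m' k' e' p' r' f' i' j' l' z hz hj El.
  have e1 : (m' + m)%N = (m' + m).-1.+1 by have := ltn_ord i; lia.
  have e2 : ((m' + m).-1 + n)%N = k'.+1 by have := ltn_ord i; lia.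
  have f2 : p' + p + q = r' by rewrite -addrA f.
  rewrite -(pcompA e1 e2 e e' erefl f2 f f' _ _ _ (erefl : inner_label e1 i' i = (i' + i)%N :> nat)).
  have h1 : outer_label e1 hj != inner_label e1 i' i.
    apply/negP => /eqP/(congr1 val) /=; move: (ord_neq hj).
    by rewrite /outer; case: ifP; have := ltn_ord i; lia.
  apply: (sy _ _ _ _ _ _ _ (outer_label e1 hj)) => //.
    exact: (sx _ _ _ _ _ _ _ j').
  move: (ord_neq hj); rewrite El /= /outer.
  by have := ltn_ord i; do ![case: ifP]; lia.
- move=> n p; split=> [j|]; first exact: ln_zero.
  by move=> *; rewrite pcomp0r; exact: ln_zero.
- move=> n p x [h1 h2]; rewrite clsN; split=> [j|]; first exact/ln_opp.
  by move=> m k e p' r f i j l z hz hj El; rewrite pcompNr; apply: ln_opp; exact: (h2 _ _ _ _ _ _ _ j).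
- move=> n p x [h1 h2] y [g1 g2]; rewrite clsD; split=> [j|]; first exact/ln_add.
  move=> m k e p' r f i j l z hz hj El; rewrite pcompDr.
  by apply: ln_add; [exact: (h2 _ _ _ _ _ _ _ j)|exact: (g2 _ _ _ _ _ _ _ j)].
Qed.

Definition lie_unit (p : int) : PLie 1 p := if p is Posz 0 then (liec TId) else 0.

(** The left-normed word [..[[0, 1], 2].., n - 1]. *)
Fixpoint lword n (p : int) : PLie n p :=
  match n with
  | 0 => 0
  | n'.+1 => match n' return PLie n' p -> PLie n'.+1 p with
      | 0 => fun _ => lie_unit p
      | m.+1 => fun w => pcomp (erefl : (2 + m.+1)%N = m.+3) (add0r p) o1 br w
      end (lword n' p)
  end.

Lemma lword1 p : lword 1 p = lie_unit p. Proof. by []. Qed.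
Lemma lwordS m p : lword m.+2 p =
  pcomp (erefl : (2 + m.+1)%N = m.+3) (add0r p) o1 br (lword m.+1 p).
Proof. by []. Qed.

(** lnorm with relabellings pushed to the outside, where they act on the
fixed word lword. *)
Inductive lspan n p (j : 'I_n) : PLie n p -> Prop :=
| ls_word (s : 'S_n) (i : 'I_n) : i = 0%N :> nat -> s i = j -> lspan j (pact s (lword n p))
| ls_zero : lspan j 0
| ls_opp x : lspan j x -> lspan j (- x)
| ls_add x y : lspan j x -> lspan j y -> lspan j (x + y).

Lemma lnorm_span n p j (x : PLie n p) : lnorm j x -> lspan j x.
Proof.
elim=> {n p j x}.
- move=> i; have -> : (liec TId) = pact 1%g (lword 1 0) by rewrite pact1.
  by apply: (ls_word _ (i := i)); rewrite ?perm1 // (ord1 i).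
- move=> n p s j x _; elim=> {x}.
  + move=> t i i0 E; rewrite -pactM.
    by apply: (ls_word _ i0); rewrite permM E.
  + by rewrite pact0; exact: ls_zero.
  + by move=> x _; rewrite pactN; exact: ls_opp.
  + by move=> x y _ + _; rewrite pactD; exact: ls_add.
- move=> n k e p f i j x Ej _; elim=> {x}.
  + case: n i e Ej => [[] //|n] i e Ej t i' i'0 E.
    have ek : k = n.+2 by lia.
    subst k; have [u hu] := block_perm_exists e o1 1%g t.
    rewrite -[br]pact1 -{1}[o1](perm1) (pcomp_act _ _ _ _ hu).
    have -> : pcomp e f o1 br (lword n.+1 p) = lword n.+2 p.
      by rewrite lwordS; exact: pcomp_irr.
    apply: (ls_word _ (i := inner_label e o1 i')); first by rewrite /= i'0.
    by apply: val_inj; rewrite /= (hu.2 i' (inner_label e o1 i') erefl) perm1 E Ej.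
  + by rewrite pcomp0r; exact: ls_zero.
  + by move=> x _; rewrite pcompNr; exact: ls_opp.
  + by move=> x y _ + _; rewrite pcompDr; exact: ls_add.
- by move=> *; exact: ls_zero.
- by move=> n p i x _; exact: ls_opp.
- by move=> n p i x y _ + _; exact: ls_add.
Qed.

Lemma lspan_sum n p j (x : PLie n p) : lspan j x -> exists c : 'S_n -> int,
  x = \sum_s pact s (lword n p) *~ c s /\
  forall s, c s != 0 -> exists2 i : 'I_n, i = 0%N :> nat & s i = j.
Proof.
elim=> {x}.
- move=> s i i0 si; exists (fun t => (t == s)%:R); split; last first.
    by move=> t; case: (eqVneq t s) => [-> _|_] //; exists i.
  rewrite (bigD1 s) //= eqxx mulr1z big1 ?addr0 // => t /negbTE ->.
  by rewrite mulr0z.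
- exists (fun _ => 0); split=> [|s]; last by rewrite eqxx.
  by rewrite big1 // => s _; rewrite mulr0z.
- move=> x _ [c [-> hc]]; exists (fun s => - c s); split=> [|s].
    by rewrite -sumrN; apply: eq_bigr => s _; rewrite mulrNz.
  by rewrite oppr_eq0; exact: hc.
- move=> x y _ [c [-> hc]] _ [d [-> hd]]; exists (fun s => c s + d s); split=> [|s].
    by rewrite -big_split; apply: eq_bigr => s _; rewrite mulrzDr.
  case: (eqVneq (c s) 0) => [->|/hc //]; rewrite add0r; exact: hd.
Qed.

Lemma lie_expansion n p (j : 'I_n) (x : PLie n p) : exists c : 'S_n -> int,
  x = \sum_s pact s (lword n p) *~ c s /\
  forall s, c s != 0 -> exists2 i : 'I_n, i = 0%N :> nat & s i = j.
Proof.
have [t ->] := cls_surj x; apply/lspan_sum/lnorm_span.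
by have [h _] := lnorm_all t; exact: h.
Qed.

(** * Evaluation of Lambda in a ring *)

Section Eval.
Variable M : pzRingType.

(** A total function on numbers spares the inputs of a composite a proof of their bound. *)
Definition ext n (v : 'I_n -> M) (l : nat) : M := oapp v 0 (insub l).

Lemma extE n (v : 'I_n -> M) (l : 'I_n) l' : l' = l :> nat -> ext v l' = v l.
Proof. by move=> ->; rewrite /ext valK. Qed.

(** The values of the inputs of x in a composite of x with y at i, given the
values v of the inputs of the composite. *)
Definition comp_env m n k (i : 'I_m) (y : ('I_n -> M) -> M) (v : 'I_k -> M) (j : 'I_m) : M :=
  if j == i then y (fun t : 'I_n => ext v (i + t)%N) else ext v (outer n i j).

Fixpoint eval n p (x : term lambda_sig n p) : ('I_n -> M) -> M :=
  match x with
  | TGen LambdaA => fun v => v o1 * v o2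
  | TGen LambdaB => fun v => 0
  | TId => fun v => v ord0
  | TAct n p s x => fun v => eval x (v \o s)
  | TComp m n k e p q r f i x y => fun v => eval x (comp_env i (eval y) v)
  | TZero n p => fun v => 0
  | TOpp n p x => fun v => - eval x v
  | TAdd n p x y => fun v => eval x v + eval y v
  end.

(** Evaluations are multilinear. *)
Lemma evalD n p (x : term lambda_sig n p) i (z v w : 'I_n -> M) :
  (forall j, j != i -> v j = z j /\ w j = z j) -> z i = v i + w i ->
  eval x z = eval x v + eval x w.
Proof.
elim: x i z v w => {n p} /=.
- case; last by rewrite addr0.
  elim/ord2P => z v w h E.
    by have [-> ->] := h o2 isT; rewrite E mulrDl.
  by have [-> ->] := h o1 isT; rewrite E mulrDr.
- by move=> i z v w _; rewrite (ord1 i).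
- move=> n p s x IH i z v w h E; apply: (IH (s^-1%g i)); last by rewrite /= permKV.
  move=> j hj; apply: h; apply: contra hj => /eqP <-; by rewrite permK.
- move=> m n k e p q r f i x IHx y IHy l z v w h E.
  case: (originP e i l) => [j hj El|j El].
  + apply: (IHx j) => [j' hj'|]; rewrite /comp_env; last first.
      by rewrite (negbTE hj) -El !(extE _ (l := l)).
    case: (eqVneq j' i) => [_|hi].
      suff H (t : 'I_n) : ext v (i + t) = ext z (i + t) /\ ext w (i + t) = ext z (i + t).
        by split; congr eval; apply/funext => t; have [] := H t.
      rewrite !(extE _ (l := inner_label e i t)) //; apply: h.
      apply/negP => /eqP/(congr1 val) /=; rewrite El; move: (ord_neq hj).
      by rewrite /outer; case: ifP; have := ltn_ord t; lia.
    rewrite !(extE _ (l := outer_label e hi)) //; apply: h.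
    apply/negP => /eqP/(congr1 val) /=; rewrite El; move: (ord_neq hj) (ord_neq hi) (ord_neq hj').
    by rewrite /outer; do ![case: ifP]; lia.
  + apply: (IHx i) => [j' hj'|]; rewrite /comp_env.
      rewrite (negbTE hj') !(extE _ (l := outer_label e hj')) //; apply: h.
      apply/negP => /eqP/(congr1 val) /=; rewrite El; move: (ord_neq hj').
      by rewrite /outer; case: ifP; have := ltn_ord j; lia.
    rewrite eqxx; apply: (IHy j) => [t ht|]; last by rewrite !(extE _ (l := l)).
    rewrite !(extE _ (l := inner_label e i t)) //; apply: h.
    by apply/negP => /eqP/(congr1 val) /=; rewrite El; move: (ord_neq ht); lia.
- by move=> *; rewrite addr0.
- by move=> n p x IH i z v w h E; rewrite (IH i z v w h E) opprD.
- move=> n p x IHx y IHy i z v w h E.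
  by rewrite (IHx i z v w h E) (IHy i z v w h E) addrACA.
Qed.

Lemma eval0 n p (x : term lambda_sig n p) i (v : 'I_n -> M) : v i = 0 -> eval x v = 0.
Proof.
move=> E; have := @evalD n p x i v v v; rewrite E addr0 => H.
by apply: (addIr (eval x v)); rewrite add0r -H.
Qed.

Lemma eval_comp0 m n k (e : (m + n)%N = k.+1) (p q r : int) (f : p + q = r) i
  (x : term lambda_sig m p) (y : term lambda_sig n q) v :
  (forall v, eval y v = 0) -> eval (TComp e f i x y) v = 0.
Proof. by move=> h; apply: (@eval0 _ _ x i); rewrite /comp_env eqxx. Qed.

(** A value in an ungraded ring does not see Koszul signs; they occur only
between operations that evaluate to zero. *)
Lemma eval_odd n p (x : term lambda_sig n p) v : oddz p -> eval x v = 0.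
Proof.
elim: x v => {n p} //=.
- by case.
- by move=> n p s x IH v /IH.
- move=> m n k e p q r f i x IHx y IHy v; rewrite -f oddzD.
  case: (boolP (oddz p)) => [/IHx -> //|_ /= oq].
  by apply: (@eval_comp0 _ _ _ e _ _ _ f) => w; exact: IHy.
- by move=> n p x IH v /IH ->; rewrite oppr0.
- by move=> n p x IHx y IHy v o; rewrite IHx // IHy // addr0.
Qed.

Lemma eval_TSigned n p b (x : term lambda_sig n p) v :
  eval (TSigned b x) v = signed b (eval x v).
Proof. by case: b. Qed.

Lemma eval_diff n p (x : term lambda_sig n p) v : eval (tdiff lambda_diff x) v = 0.
Proof.
elim: x v => {n p} //=.
- by case.
- move=> m n k e p q r f i x IHx y IHy v; rewrite IHx add0r.
  by rewrite eval_TSigned eval_comp0 // signed0.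
- by move=> n p x IH v; rewrite IH oppr0.
- by move=> n p x IHx y IHy v; rewrite IHx IHy addr0.
Qed.

Lemma eval_rel n p (x y : term lambda_sig n p) : lambda_rel x y ->
  forall v, eval x v = eval y v.
Proof.
case=> {n p x y} //= v; rewrite /comp_env /=.
- by rewrite !mulrA; exact: etrans (subrr _) (esym (subrr _)).
- by rewrite mul0r addr0.
- by rewrite !addr0.
Qed.

Lemma eval_teq n p (x y : term lambda_sig n p) : teq lambda_rel x y -> forall v, eval x v = eval y v.
Proof.
elim=> {n p x y} //=.
- by move=> n p x y h; exact: eval_rel.
- by move=> n p x y z _ + _ + v => -> ->.
- by move=> m n k e p q r f i x x' y y' _ hx _ /funext -> v; rewrite hx.
- by move=> n p x x' _ h v; rewrite h.
- by move=> n p x x' y y' _ h _ g v; rewrite h g.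
- by move=> *; exact: addrA.
- by move=> *; exact: addrC.
- by move=> *; exact: add0r.
- by move=> *; exact: addNr.
- move=> m n k e p q r f i x y z v; apply: (@evalD _ _ x i); last by rewrite /comp_env eqxx.
  by move=> j /negbTE hj; rewrite /comp_env hj.
- by move=> n p x v; congr eval; apply/funext => j; rewrite /= perm1.
- by move=> n p s t x v; congr eval; apply/funext => j; rewrite /= permM.
- move=> m n k e p q r f i s t u x y h v; congr eval; apply/funext => j.
  rewrite /comp_env /= (inj_eq perm_inj); case: (eqVneq j i) => [_|hj].
    congr eval; apply/funext => a /=.
    have E := h.2 a (inner_label e i a) erefl.
    by rewrite (extE v (esym E)) (extE (v \o u) (l := inner_label e i a)).
  have E := h.1 j (outer_label e hj) hj erefl.
  by rewrite (extE v (esym E)) (extE (v \o u) (l := outer_label e hj)).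
- move=> n e p f i x v; rewrite /comp_env (ord1 i) eqxx.
  by congr eval; apply/funext => j; rewrite (extE _ (l := j)).
- move=> m e p f i x v; congr eval; apply/funext => j; rewrite /comp_env.
  case: (eqVneq j i) => [->|/ord_neq hj].
    by rewrite (extE _ (l := i)) //= addn0.
  by rewrite (extE _ (l := j)) // /outer; case: ifP => //; lia.
- move=> m n l k g h e1 e2 e3 e4 p q r a b c f1 f2 f3 f4 i j u x y z hu v.
  congr eval; apply/funext => w; rewrite /comp_env.
  case: (eqVneq w i) => [_|hw].
    congr eval; apply/funext => t; rewrite /comp_env.
    rewrite (extE _ (l := inner_label e1 i t)) //=.
    have -> : (inner_label e1 i t == u) = (t == j).
      by rewrite -!val_eqE /= hu eqn_add2l.
    case: (eqVneq t j) => [_|ht].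
      congr eval; apply/funext => s; rewrite (extE _ (l := inner_label e3 j s)) //=.
      by rewrite hu addnA.
    rewrite (extE _ (l := outer_label e3 ht)) //=; congr ext.
    by move: (ord_neq ht); rewrite hu /outer; do ![case: ifP]; lia.
  rewrite (extE _ (l := outer_label e1 hw)) //=.
  have E : outer n i w <> u :> nat.
    by move: (ord_neq hw); rewrite hu /outer; have := ltn_ord j; do ![case: ifP]; lia.
  have -> : (outer_label e1 hw == u) = false by apply/eqP => /(congr1 val).
  congr ext; move: (ord_neq hw); rewrite hu /outer.
  by have := ltn_ord j; do ![case: ifP]; lia.
- move=> m n l k g h e1 e2 e3 e4 p q r a b c f1 f2 f3 f4 i j u v x y z hij hu hv w.
  rewrite eval_TSigned; case: (boolP (oddz q && oddz r)) => [/andP[oq or]|_].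
    rewrite [signed _ _](_ : _ = 0); last first.
      by rewrite /signed eval_comp0 ?oppr0 // => ?; exact: eval_odd.
    have E : eval (TComp e2 f2 u (TComp e1 f1 i x y) z) w = 0.
      by apply: eval_comp0 => ?; exact: eval_odd.
    exact: E.
  rewrite /=.
  have nij : j != i by apply/eqP => E; rewrite E ltnn in hij.
  congr eval; apply/funext => t; rewrite /comp_env.
  case: (eqVneq t i) => [->|hi].
    rewrite eq_sym (negbTE nij) (extE _ (l := v)) // eqxx.
    congr eval; apply/funext => d; rewrite (extE _ (l := inner_label e1 i d)) //=.
    have E : (i + d)%N <> u :> nat.
      by rewrite hu /outer; have := ltn_ord d; case: ifP; lia.
    have -> : (inner_label e1 i d == u) = false by apply/eqP => /(congr1 val).
    congr ext; rewrite hu hv /outer; have := ltn_ord d; do ![case: ifP]; lia.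
  rewrite (extE _ (l := outer_label e1 hi)) //=.
  case: (eqVneq t j) => [Et|hj].
    have -> : outer_label e1 hi == u by rewrite -val_eqE /= hu Et.
    congr eval; apply/funext => d; rewrite (extE _ (l := inner_label e3 j d)) //=.
    have E : (j + d)%N <> v :> nat by rewrite hv /outer; case: ifP; lia.
    have -> : (inner_label e3 j d == v) = false by apply/eqP => /(congr1 val).
    congr ext; rewrite hu hv /outer; do ![case: ifP]; lia.
  rewrite (extE _ (l := outer_label e3 hj)) //=.
  have E1 : outer n i t <> u :> nat.
    by move: (ord_neq hi) (ord_neq hj); rewrite hu /outer; do ![case: ifP]; lia.
  have E2 : outer l j t <> v :> nat.
    by move: (ord_neq hi) (ord_neq hj); rewrite hv /outer; do ![case: ifP]; lia.
  have -> : (outer_label e1 hi == u) = false by apply/eqP => /(congr1 val).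
  have -> : (outer_label e3 hj == v) = false by apply/eqP => /(congr1 val).
  congr ext; move: (ord_neq hi) (ord_neq hj); rewrite hu hv /outer.
  by do ![case: ifP]; lia.
Qed.

Definition evalc n (v : 'I_n -> M) p (x : PLambda n p) : M := eval (repr x) v.

Lemma evalcE n (v : 'I_n -> M) p (x : term lambda_sig n p) : evalc v (lamc x) = eval x v.
Proof. exact/eval_teq/teq_repr. Qed.

Lemma evalcB n (v : 'I_n -> M) p : {morph @evalc n v p : x y / x - y}.
Proof.
move=> x y; have [[a ->] [b ->]] := (cls_surj x, cls_surj y).
by rewrite -clsN -clsD !evalcE.
Qed.
HB.instance Definition _ n (v : 'I_n -> M) p :=
  GRing.isZmodMorphism.Build (PLambda n p) M (@evalc n v p) (@evalcB n v p).

Lemma evalc_act n (v : 'I_n -> M) p s (x : PLambda n p) : evalc v (pact s x) = evalc (v \o s) x.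
Proof. by have [t ->] := cls_surj x; rewrite pactE !evalcE. Qed.

Lemma evalc_comp m n k (e : (m + n)%N = k.+1) (p q r : int) (f : p + q = r)
  i (x : PLambda m p) (y : PLambda n q) v :
  evalc v (pcomp e f i x y) = evalc (comp_env i (fun w => evalc w y) v) x.
Proof.
have [[a ->] [b ->]] := (cls_surj x, cls_surj y).
rewrite pcompE !evalcE /=; congr eval; apply/funext => j.
rewrite /comp_env; case: eqP => // _; by rewrite evalcE.
Qed.

Lemma evalc_diff n (v : 'I_n -> M) p (x : PLambda n p) : evalc v (dl x) = 0.
Proof. by have [t ->] := cls_surj x; rewrite dlE evalcE eval_diff. Qed.

Lemma evalc_bracket v : evalc v lbr = v o1 * v o2 - v o2 * v o1.
Proof.
rewrite /lbr raddfB /= evalc_act !evalcE /=.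
by rewrite /swap12 tpermL tpermR.
Qed.
End Eval.

(** * Detection of Lie elements by elementary matrices *)

Section Path.
Variable N : nat.

(** The elementary matrix of the edge from vertex k to vertex k + 1; row
vectors record the position on the path. *)
Definition edge (k : nat) : 'M[int]_N.+1 := delta_mx (inord k) (inord k.+1).
Definition vertex (k : nat) : 'rV[int]_N.+1 := delta_mx 0 (inord k).

Lemma vertex_edge a b : (a <= N)%N -> (b <= N)%N ->
  vertex a *m edge b = if a == b then vertex b.+1 else 0.
Proof.
move=> ha hb; rewrite /vertex /edge mul_delta_mx_cond -val_eqE /= !inordK //.
by case: eqP; rewrite ?mulr1n ?mulr0n.
Qed.

(** Only the first letter has an edge that leaves vertex 0.  Among the
associative words of a left-normed word, the one that keeps the order of the
letters is the only one that starts with the first letter; it leads from vertex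
0 to vertex n + 1 if and only if the edges follow each other. *)
Lemma vertex_lword n p (r : nat -> nat) : (n <= N)%N -> r 0%N = 0%N ->
  (forall k, (0 < k <= n)%N -> (0 < r k <= N)%N) ->
  vertex 0 *m evalc (fun l : 'I_n.+1 => edge (r l)) (lie_to_lambda n.+1 p (lword n.+1 p)) =
  if (p == 0) && [forall l : 'I_n.+1, r l == l] then vertex n.+1 else 0.
Proof.
elim: n => [|n IH] hn r0 hr.
  have -> : [forall l : 'I_1, r l == l] by apply/forallP => l; rewrite (ord1 l) r0.
  rewrite lword1 andbT; case: (eqVneq p 0) => [->|].
    rewrite [lie_to_lambda _ _ _](interp_clsE lie_phi_rel TId) /=.
    by rewrite (evalcE _ TId) /= r0 vertex_edge.
  by case: p => [[]|] //= *; rewrite !raddf0 //; exact: lie_phi_rel.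
rewrite lwordS [lie_to_lambda _ _ _](interp_comp lie_phi_rel).
have -> : interp_cls lie_phi br = lbr by exact: lie_to_lambdaE.
rewrite [evalc _ _]evalc_comp evalc_bracket /comp_env /= mulmxBr !mulmxA.
have E : ext (fun l : 'I_n.+2 => edge (r l)) (outer n.+1 0 1) = edge (r n.+1).
  by rewrite (extE _ (l := ord_max)).
rewrite E [X in _ - X *m _](vertex_edge (a := 0)) //; last first.
  by have /andP[_ ->] := hr n.+1 (leqnn _).
have -> : (0%N == r n.+1) = false.
  by have /andP[h _] := hr n.+1 (leqnn _); rewrite eq_sym; apply/negbTE; rewrite -lt0n.
rewrite mul0mx subr0.
have -> : (fun t : 'I_n.+1 => ext (fun l : 'I_n.+2 => edge (r l)) (0 + t)) =
    (fun l : 'I_n.+1 => edge (r l)).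
  by apply/funext => t; rewrite (extE _ (l := widen_ord (leqnSn _) t)).
rewrite [X in X *m _]IH //; [|exact: ltnW|by move=> k hk; apply: hr; lia].
have -> : [forall l : 'I_n.+2, r l == l] =
    [forall l : 'I_n.+1, r l == l] && (r n.+1 == n.+1).
  apply/forallP/andP => [h|[/forallP h1 h2] l].
    split; last exact: (h ord_max).
    by apply/forallP => l; exact: (h (widen_ord (leqnSn _) l)).
  case: (ltnP l n.+1) => hl; first exact: (h1 (Ordinal hl)).
  by have -> : l = n.+1 :> nat by have := ltn_ord l; lia.
rewrite andbA; case: (_ && _) => /=; last by rewrite mul0mx.
rewrite vertex_edge //; last by have /andP[_ ->] := hr n.+1 (leqnn _).
by rewrite eq_sym; case: eqP => // ->.
Qed.
End Path.

(** The coefficient of the word of s is obtained by giving to the label l the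
edge that starts at the position of l in this word. *)
Lemma lie_detect n p (x : Lie n p) :
  (forall (M : pzRingType) (v : 'I_n -> M), evalc v (lie_to_lambda n p x) = 0) -> x = 0.
Proof.
case: n x => [|n] x; first by rewrite (presented_arity0 x).
have [c [-> hc]] := lie_expansion ord0 x => h.
apply: big1 => s _; case: (eqVneq p 0) => p0; last first.
  have -> : lword n.+1 p = 0; last by rewrite pact0 mul0rz.
  elim: n {x c hc h s} => [|n IH]; first by case: p p0 => [[]|].
  by rewrite lwordS IH pcomp0r.
subst p; suff -> : c s = 0 by rewrite mulr0z.
apply/eqP/negP => /negP cs.
have sord t : c t != 0 -> t ord0 = ord0.
  by case/hc => i i0; have -> : i = ord0 by apply/val_inj.
(* The label l is the letter number s^-1 l of the word of s. *)
pose v l : 'M[int]_n.+2 := edge n.+1 (s^-1%g l).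
have word t : c t != 0 -> vertex n.+1 0 *m
    evalc v (lie_to_lambda n.+1 0 (pact t (lword n.+1 0))) =
    if t == s then vertex n.+1 n.+1 else 0.
  (* Position, in the word of s, of letter number k of the word of t. *)
  move=> ct; pose r k := if (k <= n)%N then s^-1%g (t (inord k)) : nat else k.
  rewrite [lie_to_lambda _ _ _](interp_act lie_phi_rel) [evalc _ _]evalc_act.
  have -> : v \o t = fun l : 'I_n.+1 => edge n.+1 (r l).
    by apply/funext => l; rewrite /v /r /= -ltnS ltn_ord inord_val.
  rewrite [LHS]vertex_lword //=; last first.
  - move=> k /andP[k0 kn]; rewrite /r kn; apply/andP; split; last first.
      by have := ltn_ord (s^-1%g (t (inord k))); lia.
    rewrite lt0n; apply/negP => /eqP E.
    have {}E : s^-1%g (t (inord k)) = ord0 by apply/val_inj.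
    have : inord k = ord0 :> 'I_n.+1.
      by apply: (@perm_inj _ t); rewrite sord // -(sord s) // -E permKV.
    by move/(congr1 val) => /=; rewrite inordK //; lia.
  - have i0 : (inord 0 : 'I_n.+1) = ord0 by apply/val_inj; rewrite /= inordK.
    by rewrite /r /= i0 sord // -(sord s) // permK.
  congr (if _ then _ else _); apply/forallP/eqP => [H|E l].
    apply/perm.permP => l; apply: (@perm_inj _ s^-1%g); rewrite permK; apply/val_inj/eqP.
    by have := H l; rewrite /r -ltnS ltn_ord inord_val.
  by rewrite /r -ltnS ltn_ord inord_val E permK.
have mulmxMz (A : 'M[int]_n.+2) z :
    vertex n.+1 0 *m (A *~ z) = (vertex n.+1 0 *m A) *~ z by exact: raddfMz.
have wordMz t : vertex n.+1 0 *m
    evalc v (lie_to_lambda n.+1 0 (pact t (lword n.+1 0) *~ c t)) =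
    if t == s then vertex n.+1 n.+1 *~ c s else 0.
  have -> : evalc v (lie_to_lambda n.+1 0 (pact t (lword n.+1 0) *~ c t)) =
      evalc v (lie_to_lambda n.+1 0 (pact t (lword n.+1 0))) *~ c t :> 'M_n.+2.
    by rewrite (raddfMz (cfun (lie_to_lambda n.+1))); exact: raddfMz.
  rewrite [LHS]mulmxMz; case: (eqVneq (c t) 0) => [c0|/word ->].
    by rewrite c0; case: eqP => // E; rewrite -E c0 in cs *.
  by case: eqP => [->|_] //; rewrite mul0rz.
have := congr1 (mulmx (vertex n.+1 0)) (h _ v).
rewrite mulmx0 (raddf_sum (cfun (lie_to_lambda n.+1))).
rewrite (raddf_sum (@evalc _ n.+1 v 0)) mulmx_sumr.
rewrite (eq_bigr _ (fun t _ => wordMz t)) -big_mkcond big_pred1_eq.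
move/matrixP => /(_ 0 (inord n.+1)).
rewrite -scaler_int !mxE !eqxx.
by rewrite intz mulr1; apply/eqP.
Qed.

Theorem mainTheorem19 :
  exists f : dgMorphism Lie Lambda,
    [/\ f 2%N 0 lie_bracket = lambda_a - opact swap12 lambda_a,
        (forall g : dgMorphism Lie Lambda,
           g 2%N 0 lie_bracket = lambda_a - opact swap12 lambda_a ->
           forall n p (x : Lie n p), g n p x = f n p x)
      & operad_quasi_iso f].
Proof.
exists lie_to_lambda; split; first exact: lie_to_lambdaE.
  by move=> g hg n p x; apply: presented_morphism_uniq => -[].
move=> n p.
have hz (x : Lie n p) : cdiff x = 0.
  have [t ->] := cls_surj x; rewrite [LHS](pdiffE lie_diff_rel).
  elim: t => {n p x} //=.
  - by move=> n p s t IH; rewrite -pactE IH pact0.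
  - move=> m n k e p q r f i t IHt s IHs.
    by rewrite clsD clsS -!pcompE IHt IHs pcomp0l pcomp0r signed0 addr0.
  - by move=> n p t IH; rewrite clsN IH oppr0.
  - by move=> n p t IHt s IHs; rewrite clsD IHt IHs addr0.
have inj : injective (@cohomology_map _ _ (lie_to_lambda n) p).
  move=> hx hy; rewrite -[hx]reprK -[hy]reprK.
  move: (repr hx) (repr hy) => {hx hy} x y.
  rewrite !cohomology_map_pi => /eqmodP/asboolP K.
  have {K}H : coboundary (lie_to_lambda n p (val x - val y)) by rewrite raddfB.
  suff -> : x = y by [].
  apply/val_inj/eqP; rewrite -subr_eq0; apply/eqP/lie_detect => M v.
  by case: H => q z; exact: evalc_diff.
have surj (h : cohomology (Lambda n) p) : exists h', cohomology_map (lie_to_lambda n) h' = h.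
  rewrite -[h]reprK; move: (repr h) => {h} x.
  have [z hzx] := lie_onto_cohomology (eqP (valP x)).
  pose z' : cocycle (Lie n) p := exist _ z (introT eqP (hz z)).
  exists (\pi_(cohomology (Lie n) p) z').
  rewrite cohomology_map_pi; apply/eqmodP/asboolP => /=.
  by rewrite -opprB -sub0r; apply: coboundaryB => //; exact: coboundary0.
have [g hg] := choice surj.
by exists g => // x; apply: inj; rewrite hg.
Qed.
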